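(* Let $m$ be a positive integer and let $K\in C^{[m]}(I^2)$ be independent of $\kappa$. Let $(\mathcal{K}u)(s)=\int_IK(s,t)e^{i\kappa|s-t|}u(t)\,dt$. Then for every $n\in\{1,\dots,m\}$, $\mathcal{K}^n$ maps $H^m_\kappa(I)$ into $\tilde H^m_{\kappa,m-n}(I)$.
   Context: $I=[-1,1]$; $\kappa\in(1,\infty)$; functions are complex-valued; a $\kappa$-parameterized function is a family indexed by $\kappa>1$; operators act $\kappa$-wise; ''independent of $\kappa$'' means a fixed function. $C^{[m]}(I^2)$: functions on $I^2$ with continuous $\partial_s^\alpha\partial_t^\beta$ derivatives, $\alpha,\beta\le m$. $H^m(I)$ is the Sobolev space with $\|u\|_{H^p}=(\sum_{j=0}^p\|u^{(j)}\|_{L^2(I)}^2)^{1/2}$. $H^m_\kappa(I)$: $\kappa$-parameterized $u\in H^m(I)$ with positive constants $c,\kappa_0$ such that $\|u\|_{H^p}\le c\kappa^p$ for all $p\in\{0,\dots,m\}$ and $\kappa\ge\kappa_0$. For $k\ge0$, $H^m_{\kappa,k}(I)$: $\kappa$-parameterized $u\in H^m(I)$ with $\|u\|_{H^m}\le c\kappa^k$ for all $\kappa\ge\kappa_0$; $\tilde H^m_{\kappa,k}(I)=\{u_0+u_1e^{i\kappa t}+u_2e^{-i\kappa t}:u_j\in H^m_{\kappa,k}(I)\}$. *)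

(* Defs.v *)
From mathcomp Require Import all_boot all_order all_algebra.
From mathcomp Require Import all_classical all_reals all_analysis.
From mathcomp Require Import complex.
Set Implicit Arguments. Unset Strict Implicit. Unset Printing Implicit Defensive.
Import Order.TTheory GRing.Theory Num.Theory numFieldNormedType.Exports.
Local Open Scope classical_set_scope.
Local Open Scope ring_scope.

Section Defs.
Variable R : realType.
Local Notation C := R[i].
Local Notation mu := (@lebesgue_measure R).

Definition Iset : set R := `[(-1 : R), 1].
Definition Iopen : set R := `](-1 : R), 1[.

Definition ReF (f : R -> C) : R -> R := fun x => complex.Re (f x).
Definition ImF (f : R -> C) : R -> R := fun x => complex.Im (f x).

Definition cint (D : set R) (f : R -> C) : C :=
  Complex (Rintegral mu D (ReF f)) (Rintegral mu D (ImF f)).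

Definition cabs2 (z : C) : R := complex.Re z ^+ 2 + complex.Im z ^+ 2.

Definition L2I (f : R -> C) : Prop :=
  measurable_fun Iset (ReF f) /\ measurable_fun Iset (ImF f) /\
  (\int[mu]_(x in Iset) (cabs2 (f x))%:E < +oo)%E.

Definition L2sq (f : R -> C) : R := Rintegral mu Iset (fun x => cabs2 (f x)).

(* g is a chain of weak derivatives of u up to order m on I:
   g 0 = u a.e. on I, each g j (j <= m) lies in L^2(I), and
   g j is absolutely continuous with derivative g (j+1), i.e.
   g j s = g j (-1) + int_{-1}^s g (j+1), for j < m.
   (On an interval this is exactly u in H^m(I) with u^(j) = g j.) *)
Definition Hchain (m : nat) (u : R -> C) (g : nat -> R -> C) : Prop :=
  {ae mu, forall x, Iset x -> g 0%N x = u x} /\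
  (forall j, (j <= m)%N -> L2I (g j)) /\
  (forall j, (j < m)%N -> forall s, Iset s ->
     g j s = g j (-1) + cint `[(-1 : R), s] (g j.+1)).

Definition Hnorm (g : nat -> R -> C) (p : nat) : R :=
  Num.sqrt (\sum_(j < p.+1) L2sq (g j)).

Definition inH (m : nat) (u : R -> C) : Prop := exists g, Hchain m u g.

(* kappa-parameterized functions: u : R -> (R -> C), kappa |-> u kappa,
   considered for kappa > 1. *)

Definition Hkappa (m : nat) (u : R -> R -> C) : Prop :=
  exists g : R -> nat -> R -> C,
    (forall k, 1 < k -> Hchain m (u k) (g k)) /\
    exists c k0 : R, 0 < c /\ 0 < k0 /\
      forall k, 1 < k -> k0 <= k ->
        forall p, (p <= m)%N -> Hnorm (g k) p <= c * k ^+ p.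

Definition Hkappak (m e : nat) (u : R -> R -> C) : Prop :=
  exists g : R -> nat -> R -> C,
    (forall k, 1 < k -> Hchain m (u k) (g k)) /\
    exists c k0 : R, 0 < c /\ 0 < k0 /\
      forall k, 1 < k -> k0 <= k -> Hnorm (g k) m <= c * k ^+ e.

Definition expi (x : R) : C := Complex (cos x) (sin x).

(* tilde H^m_{kappa,k}(I): v = u0 + u1 e^{i kappa t} + u2 e^{-i kappa t}
   (as elements of H^m(I), i.e. a.e. on I) *)
Definition Htilde (m e : nat) (v : R -> R -> C) : Prop :=
  exists u0 u1 u2 : R -> R -> C,
    Hkappak m e u0 /\ Hkappak m e u1 /\ Hkappak m e u2 /\
    forall k, 1 < k ->
      {ae mu, forall t, Iset t ->
         v k t = u0 k t + u1 k t * expi (k * t) + u2 k t * expi (- (k * t))}.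

(* K in C^{[m]}(I^2): there are functions Kd a b = d_s^a d_t^b K
   (a, b <= m), continuous on the closed square I^2, with
   Kd 0 0 = K on I^2, Kd 0 (b+1) = d_t (Kd 0 b) and Kd (a+1) b = d_s (Kd a b)
   at interior points (the interior derivatives then extend continuously,
   i.e. one-sided derivatives at the boundary agree). *)
Definition Cm2 (m : nat) (K : R -> R -> C) : Prop :=
  exists Kd : nat -> nat -> R -> R -> C,
    (forall s t, Iset s -> Iset t -> Kd 0%N 0%N s t = K s t) /\
    (forall a b, (a <= m)%N -> (b <= m)%N ->
       {within Iset `*` Iset, continuous (fun p : R * R => complex.Re (Kd a b p.1 p.2))} /\
       {within Iset `*` Iset, continuous (fun p : R * R => complex.Im (Kd a b p.1 p.2))}) /\
    (forall b, (b < m)%N -> forall s t, Iopen s -> Iopen t ->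
       is_derive t (1 : R) (fun y => complex.Re (Kd 0%N b s y)) (complex.Re (Kd 0%N b.+1 s t)) /\
       is_derive t (1 : R) (fun y => complex.Im (Kd 0%N b s y)) (complex.Im (Kd 0%N b.+1 s t))) /\
    (forall a b, (a < m)%N -> (b <= m)%N -> forall s t, Iopen s -> Iopen t ->
       is_derive s (1 : R) (fun x => complex.Re (Kd a b x t)) (complex.Re (Kd a.+1 b s t)) /\
       is_derive s (1 : R) (fun x => complex.Im (Kd a b x t)) (complex.Im (Kd a.+1 b s t))).

Definition Kop (K : R -> R -> C) (k : R) (u : R -> C) : R -> C :=
  fun s => cint Iset (fun t => K s t * expi (k * `|s - t|) * u t).

Definition Kpow (K : R -> R -> C) (n : nat) (u : R -> R -> C) : R -> R -> C :=
  fun k => iter n (Kop K k) (u k).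

End Defs.

(* Main.v *)
Require Import Defs.
From mathcomp Require Import all_boot all_order all_algebra.
From mathcomp Require Import all_classical all_reals all_analysis.
From mathcomp Require Import complex.
From mathcomp Require Import measurable_realfun zify ring lra.
Set Implicit Arguments. Unset Strict Implicit. Unset Printing Implicit Defensive.
Import Order.TTheory GRing.Theory Num.Theory numFieldNormedType.Exports.
Local Open Scope classical_set_scope.
Local Open Scope ring_scope.

(* Write u = v0 + v1 e^{ikt} + v2 e^{-ikt}, with k for kappa, and measure the amplitudes by
   |v^(j)|_{L^2} <= C k^{max(0, j - r)} for j <= m.  This is H^m_kappa for r = 0, and it gives
   |v|_{H^m} <= C k^{m-n} for r = n, so it is enough that one application of the operator
   raises r by one.  Splitting the integral at t = s reduces this to the primitives
   b_j(s) = int_{-1}^s (d/ds)^j K(s,t) u(t) e^{i tau k t} dt, with tau in {0, 1, -1, 2, -2},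
   which satisfy b_j' = ((d/ds)^j K)(s,s) u(s) e^{i tau k s} + b_{j+1}.  Hence only the map
   f |-> int_{-1}^s f e^{i tau k t} dt has to be understood: its value has the form
   A e^{i tau k s} + B, where A and B have one more derivative and a rank r larger by one.
   For tau = 0 this is plain integration.  Otherwise let y = (1 + D/k)^{-1} f; then
   f = (1 + i/tau) y'/k - (i/tau) (D + i tau k) y/k.  The last term integrates exactly to the
   boundary terms, while y'/k is treated in the same way with r lowered by one; after r rounds
   the remainder g satisfies |g^(j)| <= C k^{j-r} for every j and can be integrated directly.
   All L^2 bounds are carried as bounds on squared norms, so constants are not sharp. *)

(** * Integrals over [[-1, 1]] *)

Section RealIntegral.
Variable R : realType.
Local Notation mu := (@lebesgue_measure R).
Local Notation I := (@Iset R).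

(** The obstacle is that ordinary integration by parts differentiates [f], so the amplitude would
    lose a derivative where one has to be gained. The smoothed [y] avoids this: it has one
    derivative more than [f], and the factor k that y' may cost is repaid by the quotient y'/k. A
    second loss sits in the phase: every derivative of e^{i tau k t} costs k, so the integral of a
    remainder g e^{i tau k t} can be estimated only if each derivative of g is allowed a factor k as
    well. Hence the repeated rounds, which trade the rank r of [f] for a remainder of rank 0 that is
    small of order k^{-r}. The five frequencies are sigma - 1 and sigma + 1 with sigma in {0, 1,
    -1}: the split kernel contributes a phase -k or k to an amplitude of phase sigma k, and what
    returns has phase sigma k, k or -k again. The m-th s-derivative of K is merely continuous, so
    b_m has nothing but an L^2 bound, and the climb goes from j = m down to j = 0, each integration
    giving back one derivative. The diagonal terms also require t-derivatives of K. *)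

Lemma measurable_Iset : measurable I.
Proof. exact: measurable_itv. Qed.

Lemma Iset_itv (x : R) : I x <-> -1 <= x <= 1.
Proof. by rewrite /Iset /= in_itv. Qed.

Lemma mu_Iset : mu I = 2%:E.
Proof.
rewrite /Iset lebesgue_measure_itv /= lte_fin ifT; last by lra.
by rewrite -EFinD; congr EFin; lra.
Qed.

(** Extension of [psi] and [phi] by zero and boundedness of [G] make the triple product integrable
    on the plane. The integrability conclusion is kept because the measurability of kernel integrals
    is later read off from it. *)
Lemma Rintegral_Fubini (A B : set R) (G : R * R -> R) (psi phi : R -> R) (M : R) :
  measurable A -> measurable B -> measurable_fun setT G ->
  (forall p, `|G p| <= M) ->
  mu.-integrable A (EFin \o psi) -> mu.-integrable B (EFin \o phi) ->
  mu.-integrable A (EFin \o (fun x => psi x * \int[mu]_(t in B) (G (x, t) * phi t))) /\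
  \int[mu]_(x in A) (psi x * \int[mu]_(t in B) (G (x, t) * phi t)) =
  \int[mu]_(t in B) (phi t * \int[mu]_(x in A) (G (x, t) * psi x)).
Proof.
move=> mA mB mG GM ipsi iphi.
pose p := psi \_ A; pose q := phi \_ B.
have ip : mu.-integrable setT (EFin \o p).
  by have := ipsi; rewrite integrable_mkcond//= (restrict_EFin psi).
have iq : mu.-integrable setT (EFin \o q).
  by have := iphi; rewrite integrable_mkcond//= (restrict_EFin phi).
have mp : measurable_fun setT p by apply/measurable_EFinP; exact: measurable_int ip.
have mq : measurable_fun setT q by apply/measurable_EFinP; exact: measurable_int iq.
pose f (z : R * R) : \bar R := (p z.1 * q z.2 * G z)%:E.
have mf : measurable_fun setT f.
  apply/measurable_EFinP; apply: measurable_funM => //.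
  by apply: measurable_funM; [exact: (measurableT_comp mp)|exact: (measurableT_comp mq)].
have M0 : 0 <= M by apply: le_trans (GM (0, 0)).
have iG1 (x : R) : mu.-integrable setT (EFin \o (fun t => G (x, t) * q t)).
  apply: (@le_integrable _ _ _ mu setT measurableT _ (fun t => M%:E * (EFin \o q) t)%E).
  - apply/measurable_EFinP; apply: measurable_funM => //.
    by apply: measurableT_comp => //; exact: pair1_measurable.
  - move=> t _ /=; rewrite lee_fin !normrM [`|M|]ger0_norm//.
    by rewrite ler_wpM2r.
  - exact: integrableZl.
have iG2 (t : R) : mu.-integrable setT (EFin \o (fun x => G (x, t) * p x)).
  apply: (@le_integrable _ _ _ mu setT measurableT _ (fun t => M%:E * (EFin \o p) t)%E).
  - apply/measurable_EFinP; apply: measurable_funM => //.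
    by apply: measurableT_comp => //; exact: pair2_measurable.
  - move=> x _ /=; rewrite lee_fin !normrM [`|M|]ger0_norm//.
    by rewrite ler_wpM2r.
  - exact: integrableZl.
have intf : (mu \x mu)%E.-integrable setT f.
  apply/integrable12ltyP; first exact: mf.
  pose cq := fine (\int[mu]_t `|q t|%:E)%E.
  have iqn : mu.-integrable setT (EFin \o (fun t => `|q t|)) by exact: integrable_norm.
  have cqE : (\int[mu]_t `|q t|%:E)%E = cq%:E.
    by rewrite /cq fineK//; exact: (integrable_fin_num measurableT iqn).
  apply: (@le_lt_trans _ _ (\int[mu]_x (M * cq * `|p x|)%:E)%E).
    apply: ge0_le_integral => //.
    - by move=> x _; apply: integral_ge0.
    - have maf : measurable_fun setT (abse \o f) by exact: measurableT_comp.
      by have := measurable_fun_fubini_tonelli_F (m2 := mu) (abse \o f) maf (fun=> abse_ge0 _).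
    - apply/measurable_EFinP; apply: measurable_funM => //.
      exact: measurableT_comp.
    move=> x _.
    have -> : (M * cq * `|p x|)%:E = (\int[mu]_t ((M * `|p x|)%:E * (`|q t|)%:E))%E.
      have -> := integralZl measurableT iqn (M * `|p x|).
      by rewrite cqE -EFinM; congr EFin; ring.
    apply: ge0_le_integral => //.
    - have mfx : measurable_fun setT (fun t => p x * q t * G (x, t)).
        apply: measurable_funM; first by apply: measurable_funM.
        exact: (measurableT_comp mG (pair1_measurable x)).
      have mfx' : measurable_fun setT (abse \o (EFin \o (fun t => p x * q t * G (x, t)))).
        by apply: measurableT_comp => //; exact/measurable_EFinP.
      exact: mfx'.
    - have mq' : measurable_fun setT (EFin \o (fun t => M * `|p x| * `|q t|)).
        apply/measurable_EFinP; apply: measurable_funM => //.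
        exact: measurableT_comp.
      exact: mq'.
    move=> t _; rewrite /f /= lee_fin !normrM.
    by rewrite -[leRHS]mulrA [leRHS]mulrC; apply: ler_wpM2l => //; rewrite mulr_ge0.
  have := integrableZl measurableT (M * cq) (integrable_norm ip).
  move/(integrable_lty measurableT).
  by under eq_integral do rewrite /= -EFinM.
have E := Fubini intf.
have E1 : (fun x => (\int[mu]_t f (x, t))%E) = (fun x => (p x * \int[mu]_(t in B) (G (x, t) * phi t))%:E).
  apply/funext => x; rewrite /f /=.
  under eq_integral do rewrite -mulrA EFinM [(q _ * _)]mulrC.
  rewrite integralZl //; last exact: iG1.
  rewrite EFinM; congr (_ * _)%E.
  rewrite Rintegral_mkcond /Rintegral fineK.
    apply: eq_integral => t _; rewrite /= /q !patchE.
    by case: ifP => // _; rewrite mulr0.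
  have := integrable_fin_num measurableT (iG1 x).
  congr (_ \is a fin_num); apply: eq_integral => t _; rewrite /= /q !patchE.
  by case: ifP => // _; rewrite mulr0.
have E2 : (fun t => (\int[mu]_x f (x, t))%E) = (fun t => (q t * \int[mu]_(x in A) (G (x, t) * psi x))%:E).
  apply/funext => t; rewrite /f /=.
  under eq_integral do rewrite [p _ * _]mulrC -mulrA EFinM [(p _ * _)]mulrC.
  rewrite integralZl //; last exact: iG2.
  rewrite EFinM; congr (_ * _)%E.
  rewrite Rintegral_mkcond /Rintegral fineK.
    apply: eq_integral => x _; rewrite /= /p !patchE.
    by case: ifP => // _; rewrite mulr0.
  have := integrable_fin_num measurableT (iG2 t).
  congr (_ \is a fin_num); apply: eq_integral => x _; rewrite /= /p !patchE.
  by case: ifP => // _; rewrite mulr0.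
split.
  have := integrable_fubini_F intf; rewrite /fubini_F E1 => iF.
  have iFA : mu.-integrable A (fun x => (p x * \int[mu]_(t in B) (G (x, t) * phi t))%:E).
    by apply: integrableS iF => //.
  by apply: eq_integrable iFA => // x xA; rewrite /p /= patchE xA.
rewrite Rintegral_mkcond [RHS]Rintegral_mkcond /Rintegral; congr fine.
transitivity (\int[mu]_x (\int[mu]_t f (x, t)))%E.
  rewrite E1; apply: eq_integral => x _; rewrite /p !patchE.
  by case: ifP => // _; rewrite mul0r.
rewrite E.
transitivity (\int[mu]_t (\int[mu]_x f (x, t)))%E => //.
rewrite E2; apply: eq_integral => x _; rewrite /q !patchE.
by case: ifP => // _; rewrite mul0r.
Qed.
End RealIntegral.

(** * Square-integrable functions and their absolutely continuous primitives *)

Section RealPrimitive.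
Variable R : realType.
Local Notation mu := (@lebesgue_measure R).
Local Notation I := (@Iset R).

Lemma sqrrD_le (a b : R) : (a + b) ^+ 2 <= 2 * a ^+ 2 + 2 * b ^+ 2.
Proof. by have := sqr_ge0 (a - b); rewrite !expr2; lra. Qed.

Definition rint (f : R -> R) (s : R) : R := \int[mu]_(x in `[-1, s]) f x.
Definition rintegrable (f : R -> R) := mu.-integrable I (EFin \o f).

Lemma Iset_m1 : I (-1). Proof. by apply/Iset_itv; lra. Qed.
Lemma Iset_1 : I 1. Proof. by apply/Iset_itv; lra. Qed.
Lemma measurable_IsetR : @measurable _ (measurableTypeR R) I.
Proof. exact: measurable_Iset. Qed.
Lemma measurable_EFin_IsetR (f : R -> R) : measurable_fun I f ->
  @measurable_fun _ _ (measurableTypeR R) _ I (EFin \o f).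
Proof. by move=> mf; exact: ((measurable_EFinP _ _).2 mf). Qed.
Hint Resolve measurable_IsetR Iset_m1 Iset_1 measurable_Iset : core.

Lemma subI (s : R) : I s -> `[-1, s] `<=` I.
Proof. by move=> /Iset_itv h x /=; rewrite in_itv /= => hx; apply/Iset_itv; lra. Qed.

Lemma subI_itv (t s : R) : I t -> I s -> `[t, s] `<=` I.
Proof.
move=> /Iset_itv h /Iset_itv h' x /=; rewrite in_itv /= => hx; apply/Iset_itv; lra.
Qed.

Lemma rintegrableS (f : R -> R) s : I s -> rintegrable f -> mu.-integrable `[-1, s] (EFin \o f).
Proof. by move=> Is; apply: integrableS; [exact: measurable_Iset|exact: measurable_itv|exact: subI]. Qed.

Lemma rintegrable_meas f : rintegrable f -> measurable_fun I f.
Proof. by move=> h; apply/measurable_EFinP; exact: measurable_int h. Qed.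

Lemma rintegrable_le (f g : R -> R) : measurable_fun I f -> rintegrable g ->
  (forall x, I x -> `|f x| <= g x) -> rintegrable f.
Proof.
move=> mf ig fg; apply: (@le_integrable _ _ _ mu I _ (EFin \o f) (EFin \o g)) => //.
- exact: measurable_EFin_IsetR.
- by move=> x Ix /=; rewrite lee_fin; apply: le_trans (fg x Ix) _; exact: ler_norm.
Qed.

Lemma rintegrableD (f g : R -> R) : rintegrable f -> rintegrable g ->
  rintegrable (fun x => f x + g x).
Proof.
move=> hf hg; have h := integrableD measurable_IsetR hf hg.
by apply: eq_integrable h => // x _ /=; rewrite EFinD.
Qed.

Lemma rintegrableZ c (f : R -> R) : rintegrable f -> rintegrable (fun x => c * f x).
Proof.
move=> hf; have h := integrableZl measurable_IsetR c hf.
by apply: eq_integrable h => // x _ /=; rewrite EFinM.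
Qed.

Lemma rintegrable_cst c : rintegrable (cst c).
Proof.
apply: measurable_bounded_integrable => //.
  have -> : (mu I < +oo)%E by rewrite mu_Iset ltry.
  by [].
exists `|c|; split; first exact: num_real.
by move=> y hy x _ /=; exact: ltW.
Qed.

Lemma rintegrable_bounded (f : R -> R) M : measurable_fun I f ->
  (forall x, I x -> `|f x| <= M) -> rintegrable f.
Proof. by move=> mf fM; apply: (rintegrable_le mf (rintegrable_cst M)). Qed.

Lemma eq_rint f g s : I s -> (forall x, I x -> f x = g x) -> rint f s = rint g s.
Proof.
by move=> Is h; apply: eq_Rintegral => x; rewrite inE => hx; apply: h; exact: subI hx.
Qed.

Lemma rintD f g s : I s -> rintegrable f -> rintegrable g ->
  rint (fun x => f x + g x) s = rint f s + rint g s.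
Proof. by move=> Is hf hg; apply: RintegralD => //; exact: rintegrableS. Qed.

Lemma rintZ c f s : I s -> rintegrable f -> rint (fun x => c * f x) s = c * rint f s.
Proof. by move=> Is hf; apply: RintegralZl => //; exact: rintegrableS. Qed.

Lemma rint_m1 f : rint f (-1) = 0.
Proof. by rewrite /rint set_itv1 Rintegral_set1. Qed.

Lemma rint_le f g s : I s -> rintegrable f -> rintegrable g ->
  (forall x, I x -> f x <= g x) -> rint f s <= rint g s.
Proof.
move=> Is hf hg h; apply: le_Rintegral; [by []|exact: rintegrableS|exact: rintegrableS|].
by move=> x hx; apply: h; exact: subI hx.
Qed.

Lemma rintB_itv f t s : I t -> I s -> t <= s -> rintegrable f ->
  \int[mu]_(x in `[t, s]) f x = rint f s - rint f t.
Proof.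
move=> It Is ts hf; rewrite /rint Rintegral_itvB ?bnd_simp//.
- rewrite Rintegral_itv_obnd_cbnd//; apply: integrableS hf => //.
  by apply: subset_trans (subI_itv It Is); exact: subset_itv_oc_cc.
- exact: rintegrableS.
- by move: It => /Iset_itv/andP[].
Qed.

Lemma rint_cst c s : I s -> rint (cst c) s = c * (s + 1).
Proof.
move=> /Iset_itv /andP[s1 s2].
have E : mu `[-1, s] = (s + 1)%:E.
  rewrite lebesgue_measure_itv /= lte_fin.
  case: ltP => h; first by rewrite -EFinD; congr EFin; lra.
  by congr EFin; lra.
rewrite /rint [LHS]Rintegral_cst; last exact: measurable_itv.
by congr (_ * _); transitivity (fine (s + 1)%:E) => //; rewrite -E.
Qed.

Definition rL2 (f : R -> R) := measurable_fun I f /\ rintegrable (fun x => f x ^+ 2).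

Lemma rL2_le (f g : R -> R) : measurable_fun I f -> rintegrable g ->
  (forall x, I x -> f x ^+ 2 <= g x) -> rL2 f.
Proof.
move=> mf ig fg; split => //; apply: (rintegrable_le _ ig) => [|x Ix].
  exact: measurable_funX.
by rewrite ger0_norm ?sqr_ge0//; exact: fg.
Qed.

Lemma rL2M f g : rL2 f -> rL2 g -> rintegrable (fun x => f x * g x).
Proof.
move=> [mf hf] [mg hg]; apply: (rintegrable_le _ (rintegrableD hf hg)).
  exact: measurable_funM.
by move=> x _; rewrite ler_norml; apply/andP; split; nra.
Qed.

Lemma rL2_bounded (f : R -> R) M : measurable_fun I f ->
  (forall x, I x -> f x ^+ 2 <= M) -> rL2 f.
Proof. by move=> mf fM; apply: (rL2_le mf (rintegrable_cst M)). Qed.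

Lemma rL2_cst c : rL2 (cst c).
Proof. by apply: (@rL2_bounded _ (c ^+ 2)). Qed.

Lemma rL2_int f : rL2 f -> rintegrable f.
Proof.
move=> hf; have := rL2M hf (rL2_cst 1).
by apply: eq_integrable => // x _ /=; rewrite mulr1.
Qed.

Lemma rL2D f g : rL2 f -> rL2 g -> rL2 (fun x => f x + g x).
Proof.
move=> hf hg; apply: (@rL2_le _ (fun x => 2 * f x ^+ 2 + 2 * g x ^+ 2)).
- by apply: measurable_funD; [case: hf|case: hg].
- by apply: rintegrableD; apply: rintegrableZ; [case: hf|case: hg].
- by move=> x _; exact: sqrrD_le.
Qed.

Lemma rL2_mul_bounded (f g : R -> R) M : measurable_fun I g -> (forall x, I x -> g x ^+ 2 <= M) ->
  rL2 f -> rL2 (fun x => g x * f x).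
Proof.
move=> mg gM [mf hf]; apply: (@rL2_le _ (fun x => M * f x ^+ 2)).
- exact: measurable_funM.
- exact: rintegrableZ.
- by move=> x Ix; rewrite exprMn; apply: ler_wpM2r; [exact: sqr_ge0|exact: gM].
Qed.

Lemma rL2Z c f : rL2 f -> rL2 (fun x => c * f x).
Proof. by apply: (@rL2_mul_bounded _ (cst c) (c ^+ 2)). Qed.

Lemma eq_rL2 f g : (forall x, I x -> f x = g x) -> rL2 f -> rL2 g.
Proof.
move=> h [mf hf]; split; first by apply: eq_measurable_fun mf => x; rewrite inE; exact: h.
by apply: eq_integrable hf => // x; rewrite inE /= => Ix; rewrite h.
Qed.

Lemma rint_ge0 f s : I s -> (forall x, I x -> 0 <= f x) -> 0 <= rint f s.
Proof. by move=> Is h; apply: Rintegral_ge0 => x hx; apply: h; exact: subI hx. Qed.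

Lemma rint_mono f s : I s -> rintegrable f -> (forall x, I x -> 0 <= f x) ->
  rint f s <= rint f 1.
Proof.
move=> Is hf h; rewrite -subr_ge0 -rintB_itv//; last by move: Is => /Iset_itv/andP[].
by apply: Rintegral_ge0 => x hx; apply: h; exact: (subI_itv Is Iset_1).
Qed.

(** Expand the integral of (f - l)^2 >= 0 with l half of the integral of f; the factor 2 is the
    length of I. Dividing by 2 instead of s + 1 keeps the argument valid at s = -1. *)
Lemma rint_CS f s : I s -> rL2 f -> rint f s ^+ 2 <= 2 * rint (fun x => f x ^+ 2) 1.
Proof.
move=> Is hf; have if2 := hf.2; have if1 := rL2_int hf.
set l := rint f s / 2.
have : 0 <= rint (fun x => f x ^+ 2 + ((- (2 * l)) * f x + l ^+ 2)) s.
  by apply: rint_ge0 => // x _; rewrite (_ : _ + _ = (f x - l) ^+ 2) ?sqr_ge0//; ring.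
rewrite rintD//; last first.
  by apply: rintegrableD; [exact: rintegrableZ|exact: rintegrable_cst].
rewrite rintD//; [|exact: rintegrableZ|exact: rintegrable_cst].
rewrite rintZ// rint_cst//.
have le1 : rint (fun x => f x ^+ 2) s <= rint (fun x => f x ^+ 2) 1.
  by apply: rint_mono => // x _; exact: sqr_ge0.
move: Is => /Iset_itv /andP[s1 s2].
have : l ^+ 2 * (s + 1) <= l ^+ 2 * 2 by apply: ler_wpM2l; [exact: sqr_ge0|lra].
rewrite /l; nra.
Qed.

(** Absolute continuity with an L^2 derivative, in integrated form, so that nothing has to be
    differentiated almost everywhere. *)
Definition rprim (F f : R -> R) := rL2 f /\ forall s, I s -> F s = F (-1) + rint f s.

Lemma rprim_rint f : rL2 f -> rprim (rint f) f.
Proof. by move=> hf; split => // s Is; rewrite rint_m1 add0r. Qed.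

Lemma rint_meas f : rintegrable f -> measurable_fun I (rint f).
Proof.
move=> hf; apply: subspace_continuous_measurable_fun => //.
by apply: parameterized_integral_continuous => //; lra.
Qed.

Lemma rprim_meas F f : rprim F f -> measurable_fun I F.
Proof.
move=> [hf hF].
have : measurable_fun I (fun x => F (-1) + rint f x).
  by apply: measurable_funD => //; apply: rint_meas; exact: rL2_int.
by apply: eq_measurable_fun => x; rewrite inE => Ix; rewrite (hF _ Ix).
Qed.

Lemma rprim_bounded F f : rprim F f -> exists M, forall s, I s -> F s ^+ 2 <= M.
Proof.
move=> [hf hF]; exists (2 * F (-1) ^+ 2 + 4 * rint (fun x => f x ^+ 2) 1) => s Is.
have := rint_CS Is hf; rewrite (hF _ Is); have := sqrrD_le (F (-1)) (rint f s); lra.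
Qed.

Lemma rprim_L2 F f : rprim F f -> rL2 F.
Proof.
by move=> h; have [M hM] := rprim_bounded h; exact: (rL2_bounded (rprim_meas h) hM).
Qed.

Lemma rprimD F f G g : rprim F f -> rprim G g ->
  rprim (fun x => F x + G x) (fun x => f x + g x).
Proof.
move=> [hf hF] [hg hG]; split; first exact: rL2D.
move=> s Is; rewrite rintD//; [|exact: rL2_int|exact: rL2_int].
by rewrite (hF _ Is) (hG _ Is); ring.
Qed.

Lemma rprimZ c F f : rprim F f -> rprim (fun x => c * F x) (fun x => c * f x).
Proof.
move=> [hf hF]; split; first exact: rL2Z.
by move=> s Is; rewrite rintZ//; [rewrite (hF _ Is); ring|exact: rL2_int].
Qed.

Lemma eq_rprim F f G g : (forall x, I x -> F x = G x) -> (forall x, I x -> f x = g x) ->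
  rprim F f -> rprim G g.
Proof.
move=> FG fg [hf hF]; split; first exact: eq_rL2 hf.
by move=> s Is; rewrite -!FG// (hF _ Is) (eq_rint Is fg).
Qed.

Definition lower_triangle : set (R * R) := [set p | p.2 <= p.1].

Lemma measurable_lower_triangle : measurable lower_triangle.
Proof.
have : measurable_fun setT (fun p : R * R => (p.2 <= p.1)).
  exact: measurable_fun_ler.
by move=> /(_ measurableT [set true] Logic.I); rewrite setTI.
Qed.

Lemma lower_kernel_meas (L : R * R -> R) : measurable_fun setT L ->
  measurable_fun setT (fun p => L p * \1_lower_triangle p).
Proof.
by move=> mL; apply: measurable_funM => //; apply: measurable_indic; exact: measurable_lower_triangle.
Qed.

Lemma lower_kernel_le (L : R * R -> R) (M : R) : (forall p, `|L p| <= M) ->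
  forall p, `|L p * \1_lower_triangle p| <= M.
Proof.
move=> LM p; rewrite normrM -[leRHS]mulr1 ler_pM//.
by rewrite indicE; case: (p \in _); rewrite ?normr1 ?normr0.
Qed.

Lemma rint_lower_kernel (L : R * R -> R) (phi : R -> R) (x s : R) : x <= s ->
  rint (fun t => L (x, t) * \1_lower_triangle (x, t) * phi t) s =
  rint (fun t => L (x, t) * phi t) x.
Proof.
move=> xs; rewrite /rint.
have -> : `[-1, x]%classic = `[-1, s]%classic `&` `[-1, x]%classic.
  by rewrite setIC; apply/esym/setIidl; apply: subset_itvl; rewrite bnd_simp.
rewrite Rintegral_mkcondr; apply: eq_Rintegral => t; rewrite inE /= in_itv /= => /andP[t1 t2].
rewrite patchE (_ : (t \in `[-1, x]%classic) = (t <= x)); last first.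
  by apply/idP/idP; rewrite inE /= in_itv /= t1.
rewrite indicE; case: ifP => tx; first by rewrite mem_set//= mulr1.
by rewrite memNset ?mulr0 ?mul0r//= /lower_triangle /= tx.
Qed.

(** Dirichlet's exchange of order on the triangle -1 <= t <= x <= s: with the indicator of
    [lower_triangle] put into the kernel, both integrals run over the fixed interval [-1, s], where
    [Rintegral_Fubini] applies. *)
Lemma rint_triangle (L : R * R -> R) (psi phi : R -> R) (M s : R) :
  measurable_fun setT L -> (forall p, `|L p| <= M) ->
  rintegrable psi -> rintegrable phi -> I s ->
  rint (fun x => psi x * rint (fun t => L (x, t) * phi t) x) s =
  rint (fun t => phi t * \int[mu]_(x in `[t, s]) (L (x, t) * psi x)) s.
Proof.
move=> mL LM ipsi iphi Is.
have [_ E] := Rintegral_Fubini (measurable_itv _) (measurable_itv _)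
  (lower_kernel_meas mL) (lower_kernel_le LM) (rintegrableS Is ipsi) (rintegrableS Is iphi).
transitivity (\int[mu]_(x in `[-1, s]) (psi x *
    rint (fun t => L (x, t) * \1_lower_triangle (x, t) * phi t) s)).
  apply: eq_Rintegral => x; rewrite inE /= in_itv /= => /andP[x1 x2].
  by rewrite rint_lower_kernel.
rewrite E; apply: eq_Rintegral => t; rewrite inE /= in_itv /= => /andP[t1 t2].
congr (_ * _).
have -> : `[t, s]%classic = `[-1, s]%classic `&` `[t, s]%classic.
  by rewrite setIC; apply/esym/setIidl; apply: subset_itvr; rewrite bnd_simp.
rewrite Rintegral_mkcondr; apply: eq_Rintegral => x; rewrite inE /= in_itv /= => /andP[x1 x2].
rewrite patchE (_ : (x \in `[t, s]%classic) = (t <= x)); last first.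
  by apply/idP/idP; rewrite inE /= in_itv /= x2 andbT.
rewrite indicE; case: ifP => tx; first by rewrite mem_set//= mulr1.
by rewrite memNset ?mulr0 ?mul0r//= /lower_triangle /= tx.
Qed.

(** The product rule follows from exchanging the order in the double integral of f(x) g(t) over t <=
    x. *)
Lemma rprimM F f G g : rprim F f -> rprim G g ->
  rprim (fun x => F x * G x) (fun x => f x * G x + F x * g x).
Proof.
move=> pF pG; have [[hf hF] [hg hG]] := (pF, pG).
have if1 := rL2_int hf; have ig1 := rL2_int hg.
have [MF bF] := rprim_bounded pF; have [MG bG] := rprim_bounded pG.
split.
  apply: rL2D; last by apply: (@rL2_mul_bounded _ _ MF) => //; exact: rprim_meas pF.
  apply: (@eq_rL2 (fun x => G x * f x)); first by move=> x _; rewrite mulrC.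
  by apply: (@rL2_mul_bounded _ _ MG) => //; exact: rprim_meas pG.
move=> s Is.
have tr : rint (fun x => f x * rint g x) s = rint (fun t => g t * (rint f s - rint f t)) s.
  have m1 : measurable_fun setT (cst 1 : R * R -> R) by exact: measurable_cst.
  have h := @rint_triangle (cst 1) f g 1 s m1 _ if1 ig1 Is.
  transitivity (rint (fun x => f x * rint (fun t => cst 1 (x, t) * g t) x) s).
    apply: eq_rint => // x Ix; congr (_ * _); apply: eq_rint => // t It.
    by rewrite mul1r.
  rewrite {}h; last by move=> p; rewrite /= normr1.
  apply: eq_Rintegral => t; rewrite inE /= => ht.
  have It : I t by exact: (subI Is).
  rewrite -rintB_itv//; last by move: ht; rewrite in_itv /= => /andP[].
  by congr (_ * _); apply: eq_Rintegral => x _; rewrite mul1r.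
have hrf := rprim_L2 (rprim_rint hf); have hrg := rprim_L2 (rprim_rint hg).
have E1 : rint (fun x => f x * G x) s = G (-1) * rint f s + rint (fun x => f x * rint g x) s.
  rewrite -rintZ// -rintD//; [|exact: rintegrableZ|exact: rL2M].
  by apply: eq_rint => // x Ix; rewrite (hG _ Ix); ring.
have E2 : rint (fun x => F x * g x) s = F (-1) * rint g s + rint (fun x => g x * rint f x) s.
  rewrite -rintZ// -rintD//; [|exact: rintegrableZ|exact: rL2M].
  by apply: eq_rint => // x Ix; rewrite (hF _ Ix); ring.
have E3 : rint (fun t => g t * (rint f s - rint f t)) s =
    rint f s * rint g s - rint (fun x => g x * rint f x) s.
  transitivity (rint (fun t => rint f s * g t + (-1) * (g t * rint f t)) s).
    by apply: eq_rint => // x _; ring.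
  rewrite rintD//; [|exact: rintegrableZ|by apply: rintegrableZ; exact: rL2M].
  by rewrite !rintZ//; [ring|exact: rL2M].
rewrite rintD//; [|by apply: rL2M => //; exact: rprim_L2 pG|by apply: rL2M => //; exact: rprim_L2 pF].
by rewrite E1 E2 tr E3 (hF _ Is) (hG _ Is); ring.
Qed.

End RealPrimitive.

(** * Continuous kernels on the square *)

Section RealKernel.
Variable R : realType.
Local Notation mu := (@lebesgue_measure R).
Local Notation I := (@Iset R).
Hint Resolve measurable_IsetR Iset_m1 Iset_1 measurable_Iset : core.

(** The sigma-algebra of the plane is the product one, so an open set is exhibited as a countable
    union of squares: those with rational centre and radius 1/(n+1) that it contains. *)
Lemma continuous2_measurable (L : R * R -> R) : continuous L -> measurable_fun setT L.
Proof.
move=> cL; apply: (measurability _ (RGenOInfty.measurableE R)) => //.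
move=> _ [_ [a ->] <-]; rewrite setTI.
set D := _ @^-1` _.
have oD : open D by move/continuousP : cL; apply; exact: interval_open.
pose B (i : rat * rat * nat) : set (R * R) :=
  ball (ratr i.1.1 : R) (i.2.+1%:R^-1) `*` ball (ratr i.1.2 : R) (i.2.+1%:R^-1).
pose F i := if `[< B i `<=` D >] then B i else set0.
have mF i : measurable (F i).
  rewrite /F; case: ifP => // _; apply: measurableX; exact: measurable_ball.
suff -> : D = \bigcup_i F i.
  by apply: countable_bigcupT_measurable => //; exact: countableP.
apply/seteqP; split => p; last first.
  by move=> [i _]; rewrite /F; case: asboolP => // h /h.
move=> Dp; have /nbhs_ballP [e /= e0 he] : nbhs p D by exact: open_nbhs_nbhs.
(* Half of [e]: a square of radius d whose centre is within d of p stays within 2 d < e of p. *)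
have [n hn] : exists n : nat, n.+1%:R^-1 < e / 2.
  have [k _ hk] := near_infty_natSinv_lt (PosNum (divr_gt0 e0 (ltr0Sn R 1))).
  by exists k; apply: hk => /=.
set d : R := n.+1%:R^-1 in hn *.
have d0 : 0 < d by rewrite invr_gt0.
have rat_near (x : R) : exists q : rat, `|x - ratr q| < d.
  have [q] : exists q, ratr q \in `]x - d, x + d[ by apply: rat_in_itvoo; lra.
  rewrite in_itv /= => /andP[h1 h2]; exists q; rewrite ltr_norml; lra.
have [q1 h1] := rat_near p.1; have [q2 h2] := rat_near p.2.
exists ((q1, q2), n) => //; rewrite /F.
have -> : `[< B ((q1, q2), n) `<=` D >].
  apply/asboolP => z [z1 z2]; apply: he.
  move: z1 z2; rewrite /ball /= /ball_ /= -/d => z1 z2.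
  move: h1 h2 z1 z2; rewrite !ltr_norml => h1 h2 z1 z2.
  by split; rewrite /ball /= /ball_ /= ltr_norml; lra.
by split; rewrite /ball /= /ball_ /= -/d distrC.
Qed.

(** The retraction of the line onto [-1, 1]. Composed with it in both variables, a kernel continuous
    on the closed square becomes bounded and continuous on the whole plane. *)
Definition clamp (x : R) : R := (`|x + 1| - `|x - 1|) / 2.

Lemma Iset_clamp x : I (clamp x).
Proof.
apply/Iset_itv; rewrite /clamp.
by case: (ger0P (x + 1)) => h1; case: (ger0P (x - 1)) => h2; lra.
Qed.

Lemma clamp_id x : I x -> clamp x = x.
Proof.
move=> /Iset_itv /andP[h1 h2]; rewrite /clamp ger0_norm; last by lra.
by rewrite ler0_norm; lra.
Qed.

Lemma clamp_continuous : continuous clamp.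
Proof.
move=> x; apply: cvgMl; apply: cvgB.
- by apply: (cvg_norm (cvgD cvg_id (cvg_cst _))).
- by apply: (cvg_norm (cvgB cvg_id (cvg_cst _))).
Qed.

Definition ckern (L : R * R -> R) := continuous L /\ exists M : R, forall p, `|L p| <= M.

Lemma ckern_clamp (L : R -> R -> R) :
  {within I `*` I, continuous (fun p : R * R => L p.1 p.2)} ->
  ckern (fun p => L (clamp p.1) (clamp p.2)).
Proof.
move=> cL; split.
  move=> p.
  have /= := (subspace_continuousP _ _).1 cL (clamp p.1, clamp p.2)
    (conj (Iset_clamp _) (Iset_clamp _)).
  pose c (q : R * R) := (clamp q.1, clamp q.2).
  have cc : c @ p --> c p.
    have c1 : clamp q.1 @[q --> p] --> clamp p.1.
      by apply: (cvg_comp _ _ cvg_fst); exact: clamp_continuous.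
    have c2 : clamp q.2 @[q --> p] --> clamp p.2.
      by apply: (cvg_comp _ _ cvg_snd); exact: clamp_continuous.
    exact: (cvg_pair c1 c2).
  move=> h A /h hA.
  have hA' : nbhs (c p) [set q | (I `*` I) q -> A (L q.1 q.2)] := hA.
  have hq : nbhs p [set q | (I `*` I) (c q) -> A (L (c q).1 (c q).2)] := cc _ hA'.
  have hq' : nbhs p [set q | A (L (c q).1 (c q).2)].
    by apply: filterS hq => q /=; apply; split; exact: Iset_clamp.
  exact: hq'.
have cI : compact (I `*` I) by apply: compact_setX; exact: segment_compact.
have /compact_bounded[M [_ hM]] := continuous_compact cL cI.
exists (`|M| + 1) => p; apply: hM.
  by rewrite (le_lt_trans (ler_norm M))// ltrDl.
by exists (clamp p.1, clamp p.2) => //; split; exact: Iset_clamp.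
Qed.

Lemma ckern_meas1 L t : ckern L -> measurable_fun I (fun x => L (x, t)).
Proof.
move=> [cL _]; apply: (@measurable_funS _ _ _ _ setT) => //.
by apply: (measurableT_comp (continuous2_measurable cL)); exact: pair2_measurable.
Qed.

Lemma ckern_meas2 L x : ckern L -> measurable_fun I (fun t => L (x, t)).
Proof.
move=> [cL _]; apply: (@measurable_funS _ _ _ _ setT) => //.
by apply: (measurableT_comp (continuous2_measurable cL)); exact: pair1_measurable.
Qed.

Lemma ckern_int1 L t : ckern L -> rintegrable (fun x => L (x, t)).
Proof.
move=> cL; have [_ [M hM]] := cL.
by apply: (@rintegrable_bounded _ _ M) => //; exact: ckern_meas1.
Qed.

Lemma ckern_int2 L x : ckern L -> rintegrable (fun t => L (x, t)).
Proof.
move=> cL; have [_ [M hM]] := cL.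
by apply: (@rintegrable_bounded _ _ M) => //; exact: ckern_meas2.
Qed.

Lemma ckern_diag_meas L : ckern L -> measurable_fun I (fun x => L (x, x)).
Proof.
move=> [cL _]; apply: (@measurable_funS _ _ _ _ setT) => //.
by apply: (measurableT_comp (continuous2_measurable cL)); exact: measurable_fun_pair.
Qed.

Lemma ckern_swap L : ckern L -> ckern (fun p => L (p.2, p.1)).
Proof.
move=> [cL [M hM]]; split; last by exists M.
move=> p.
have h : (q.2, q.1) @[q --> p] --> (p.2, p.1).
  exact: (cvg_pair (@cvg_snd _ _ (nbhs p.1) (nbhs p.2) _) (@cvg_fst _ _ (nbhs p.1) (nbhs p.2) _)).
exact: (cvg_comp _ _ h (cL _)).
Qed.

Lemma ckern_cont1 L t : ckern L -> continuous (fun x => L (x, t)).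
Proof.
move=> [cL _] x.
have h : (q, t) @[q --> x] --> (x, t) by exact: (cvg_pair cvg_id (cvg_cst t)).
exact: (cvg_comp _ _ h (cL _)).
Qed.

Lemma ckern_cont2 L x : ckern L -> continuous (fun t => L (x, t)).
Proof. by move=> /ckern_swap /(@ckern_cont1 _ x). Qed.

Lemma cont_eq0 (g : R -> R) : {in I, continuous g} ->
  (forall x, @Iopen R x -> g x = 0) -> forall x, I x -> g x = 0.
Proof.
move=> cg g0 x Ix; apply/eqP; apply/negP => /negP gx.
have e0 : 0 < `|g x| by rewrite normr_gt0.
have := cg x (mem_set Ix) => /cvgrPdist_lt /(_ _ e0) /nbhs_ballP[d /= d0 hd].
(* The point x - m x is x pulled towards 0: 0 < m <= 1/2 puts it in the open interval even when x is
   an endpoint, and m <= d/2 keeps it within d of x. *)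
have [m [m0 m1 m2]] : exists m, [/\ 0 < m, m <= d / 2 & m <= 1 / 2].
  exists (Num.min (d / 2) (1 / 2)); rewrite lt_min !ge_min !lexx orbT; split => //.
  by apply/andP; split; lra.
move: Ix => /Iset_itv /andP[x1 x2].
have mx1 : - m <= m * x by nra.
have mx2 : m * x <= m by nra.
have hr : @Iopen R (x - m * x).
  by rewrite /Iopen /= in_itv /=; apply/andP; split; nra.
have : ball x d (x - m * x).
  by rewrite /ball /= /ball_ /= opprB addrC subrK ltr_norml; apply/andP; split; lra.
by move/hd; rewrite (g0 _ hr) subr0 ltxx.
Qed.

Lemma rint_cont L s : ckern L -> I s -> continuous (fun t => rint (fun x => L (x, t)) s).
Proof.
move=> cL Is t; have [_ [M hM]] := cL.
apply: (@continuity_under_integral R _ _ mu (fun t x => L (x, t)) `[-1, s]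
  (measurable_itv _) (t - 1) (t + 1) _ _ (cst M)).
- by move=> x _; apply: rintegrableS => //; exact: ckern_int1.
- by apply: aeW => x _ y _; exact: ckern_cont2.
- by apply: rintegrableS => //; exact: rintegrable_cst.
- by move=> x _; apply: aeW => y _; exact: hM.
- by rewrite inE /= in_itv /=; apply/andP; split; lra.
Qed.

Lemma FTC_Iset (F f : R -> R) : continuous F -> continuous f ->
  (forall x, @Iopen R x -> is_derive x (1 : R) F (f x)) ->
  forall s, I s -> F s = F (-1) + rint f s.
Proof.
move=> cF cf dF s /Iset_itv /andP[]; rewrite le_eqVlt => /orP[/eqP<- _|s1 s2].
  by rewrite rint_m1 addr0.
have hin x : x \in `]-1, s[ -> @Iopen R x.
  by rewrite /Iopen /= !in_itv /= => /andP[]; lra.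
have := @continuous_FTC2 R f F (-1) s s1 (continuous_subspaceT cf).
rewrite /rint /Rintegral => ->.
- by rewrite -EFinB /= addrC subrK.
- split.
  + by move=> x /hin /dF [].
  + by apply: cvg_at_right_filter; exact: cF.
  + by apply: cvg_at_left_filter; exact: cF.
- by move=> x /hin /dF h; rewrite derive1E derive_val.
Qed.

Lemma rint_eq0 (h : R -> R) : continuous h -> (forall s, I s -> rint h s = 0) ->
  forall x, I x -> h x = 0.
Proof.
move=> ch h0; apply: cont_eq0; first by move=> x _; exact: ch.
move=> x xo.
have xo' := xo; move: xo'; rewrite /Iopen /= in_itv /= => /andP[x1 x2].
have ih : mu.-integrable `[-1, 1] (EFin \o h).
  apply: continuous_compact_integrable; first exact: segment_compact.
  exact: continuous_subspaceT.
have [_ <-] := continuous_FTC1_closed x2 ih x1 (ch x).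
rewrite derive1E (@near_eq_derive _ _ _ _ (cst 0)) ?derive_cst//.
near=> y; apply: h0; apply: subset_itv_oo_cc.
near: y; exact: near_in_itvoo.
Unshelve. all: by end_near. Qed.

End RealKernel.

(** * Derivatives of integrals with a kernel, and of a kernel along the diagonal *)

Section RealVolterra.
Variable R : realType.
Local Notation mu := (@lebesgue_measure R).
Local Notation I := (@Iset R).
Hint Resolve measurable_IsetR Iset_m1 Iset_1 measurable_Iset : core.

Lemma sqr_le_norm (a M : R) : `|a| <= M -> a ^+ 2 <= M ^+ 2.
Proof. by rewrite ler_norml => /andP[h1 h2]; rewrite !expr2; nra. Qed.

Lemma ckern_intM (L : R * R -> R) (phi : R -> R) x : ckern L -> rintegrable phi ->
  rintegrable (fun t => L (x, t) * phi t).
Proof.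
move=> cL hphi; have [_ [M hM]] := cL.
apply: (@rintegrable_le _ _ (fun t => M * `|phi t|)).
- by apply: measurable_funM; [exact: ckern_meas2|exact: rintegrable_meas].
- by apply: rintegrableZ; exact: integrable_norm.
- by move=> t _; rewrite normrM ler_wpM2r.
Qed.

Lemma ckern_L2M (L : R * R -> R) (phi : R -> R) x : ckern L -> rL2 phi ->
  rL2 (fun t => L (x, t) * phi t).
Proof.
move=> cL; have [_ [M hM]] := cL.
apply: (@rL2_mul_bounded _ _ _ (M ^+ 2)); first exact: ckern_meas2.
by move=> t _; exact: sqr_le_norm.
Qed.

Lemma rintegrable_continuous (f : R -> R) : continuous f -> rintegrable f.
Proof.
move=> cf; apply: continuous_compact_integrable; first exact: segment_compact.
exact: continuous_subspaceT.
Qed.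

Lemma rint_Fubini (L : R * R -> R) (phi : R -> R) s u : ckern L -> rintegrable phi -> I s -> I u ->
  rint (fun x => rint (fun t => L (x, t) * phi t) u) s =
  rint (fun t => phi t * rint (fun x => L (x, t)) s) u.
Proof.
move=> [cL [M hM]] hphi Is Iu.
have [_] := Rintegral_Fubini (measurable_itv _) (measurable_itv _) (continuous2_measurable cL) hM
  (rintegrableS Is (rintegrable_cst 1)) (rintegrableS Iu hphi).
move=> E; transitivity (\int[mu]_(x in `[-1, s]) (cst 1 x * \int[mu]_(t in `[-1, u]) (L (x, t) * phi t))).
  by apply: eq_rint => // x _; rewrite mul1r.
rewrite E; apply: eq_rint => // t _; congr (_ * _).
by apply: eq_rint => // x _; rewrite mulr1.
Qed.

Lemma rint_fixed_int (L : R * R -> R) (phi : R -> R) : ckern L -> rintegrable phi ->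
  rintegrable (fun x => rint (fun t => L (x, t) * phi t) 1).
Proof.
move=> [cL [M hM]] hphi.
have [+ _] := Rintegral_Fubini (measurable_itv _) (measurable_itv _) (continuous2_measurable cL) hM
  (rintegrable_cst 1) hphi.
by apply: eq_integrable => // x _ /=; rewrite mul1r.
Qed.

Lemma rint_volterra_int (L : R * R -> R) (phi : R -> R) : ckern L -> rintegrable phi ->
  rintegrable (fun x => rint (fun t => L (x, t) * phi t) x).
Proof.
move=> [cL [M hM]] hphi.
have [+ _] := Rintegral_Fubini (measurable_itv _) (measurable_itv _)
  (lower_kernel_meas (continuous2_measurable cL)) (lower_kernel_le hM) (rintegrable_cst 1) hphi.
apply: eq_integrable => // x; rewrite inE /= => /Iset_itv /andP[x1 x2]; rewrite mul1r.
by rewrite -/(rint _ 1) rint_lower_kernel.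
Qed.

Lemma volterra_sqr_le (L : R * R -> R) (phi : R -> R) M x s : ckern L -> (forall p, `|L p| <= M) ->
  rL2 phi -> I s ->
  rint (fun t => L (x, t) * phi t) s ^+ 2 <= 2 * M ^+ 2 * rint (fun t => phi t ^+ 2) 1.
Proof.
move=> cL hM hphi Is; apply: (le_trans (rint_CS Is (ckern_L2M x cL hphi))).
rewrite -mulrA ler_wpM2l// -rintZ//; last by case: hphi.
apply: rint_le => //; first by case: (ckern_L2M x cL hphi).
  by apply: rintegrableZ; case: hphi.
move=> t _; rewrite exprMn ler_wpM2r ?sqr_ge0//.
exact: sqr_le_norm.
Qed.

(** [La] stands for the s-derivative of [L]; the integrated form covers the edges of the square
    without one-sided derivatives. *)
Definition primkern (L La : R * R -> R) :=
  [/\ ckern L, ckern La & forall s t, I s -> I t -> L (s, t) = L (-1, t) + rint (fun x => La (x, t)) s].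

Lemma rprim_volterra (L La : R * R -> R) phi : primkern L La -> rL2 phi ->
  rprim (fun s => rint (fun t => L (s, t) * phi t) s)
        (fun s => L (s, s) * phi s + rint (fun t => La (s, t) * phi t) s).
Proof.
move=> [cL cLa h] hphi; have ip := rL2_int hphi.
have [_ [M hM]] := cL; have [_ [M' hM']] := cLa.
have hd : rL2 (fun s => L (s, s) * phi s).
  apply: (@rL2_mul_bounded _ _ _ (M ^+ 2)) => //; first exact: ckern_diag_meas.
  by move=> s _; exact: sqr_le_norm.
have hv : rL2 (fun s => rint (fun t => La (s, t) * phi t) s).
  apply: (@rL2_bounded _ _ (2 * M' ^+ 2 * rint (fun t => phi t ^+ 2) 1)).
    by apply: rintegrable_meas; exact: rint_volterra_int.
  by move=> s Is; exact: volterra_sqr_le.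
split; first exact: rL2D.
move=> s Is; rewrite rint_m1 add0r rintD//; [|exact: rL2_int|exact: rL2_int].
have E := @rint_triangle _ La (cst 1) phi M' s (continuous2_measurable cLa.1) hM' (rintegrable_cst 1) ip Is.
have -> : rint (fun x => rint (fun t => La (x, t) * phi t) x) s =
    rint (fun x => cst 1 x * rint (fun t => La (x, t) * phi t) x) s.
  by apply: eq_rint => // x _; rewrite mul1r.
rewrite {}E.
have -> : rint (fun t => phi t * \int[mu]_(x in `[t, s]) (La (x, t) * cst 1 x)) s =
    rint (fun t => L (s, t) * phi t + (-1) * (L (t, t) * phi t)) s.
  apply: eq_Rintegral => t; rewrite inE /= => ht.
  have It : I t by exact: (subI Is).
  have -> : \int[mu]_(x in `[t, s]) (La (x, t) * cst 1 x) = \int[mu]_(x in `[t, s]) La (x, t).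
    by apply: eq_Rintegral => x _; rewrite mulr1.
  rewrite rintB_itv//; last 2 first.
  - by move: ht; rewrite in_itv /= => /andP[].
  - exact: ckern_int1.
  by rewrite (h s t) // (h t t) //; ring.
rewrite rintD//; [|exact: ckern_intM|by apply: rintegrableZ; exact: rL2_int].
by rewrite rintZ//; [ring|exact: rL2_int].
Qed.

Lemma rprim_fixed (L La : R * R -> R) phi : primkern L La -> rL2 phi ->
  rprim (fun s => rint (fun t => L (s, t) * phi t) 1)
        (fun s => rint (fun t => La (s, t) * phi t) 1).
Proof.
move=> [cL cLa h] hphi; have ip := rL2_int hphi.
have [_ [M' hM']] := cLa.
split.
  apply: (@rL2_bounded _ _ (2 * M' ^+ 2 * rint (fun t => phi t ^+ 2) 1)).
    by apply: rintegrable_meas; exact: rint_fixed_int.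
  by move=> s Is; exact: volterra_sqr_le.
move=> s Is; rewrite rint_Fubini//.
have -> : rint (fun t => phi t * rint (fun x => La (x, t)) s) 1 =
    rint (fun t => L (s, t) * phi t + (-1) * (L (-1, t) * phi t)) 1.
  by apply: eq_rint => // t It; rewrite (h s t)//; ring.
rewrite rintD//; [|exact: ckern_intM|by apply: rintegrableZ; exact: ckern_intM].
by rewrite rintZ//; [ring|exact: ckern_intM].
Qed.

(** Symmetry of mixed partials: [Lab], given as the s-derivative of [Lb] = dL/dt, is also the
    t-derivative of [La] = dL/ds. [Cm2] states t-derivatives at s-order 0 only; this lemma carries
    them to higher s-orders. *)
Lemma primkern_swap (L La Lb Lab : R * R -> R) :
  primkern L La -> primkern Lb Lab ->
  primkern (fun p => L (p.2, p.1)) (fun p => Lb (p.2, p.1)) ->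
  primkern (fun p => La (p.2, p.1)) (fun p => Lab (p.2, p.1)).
Proof.
move=> [cL cLa hLa] [cLb cLab hLb] [_ _ hL]; split; [exact: ckern_swap|exact: ckern_swap|].
move=> /= t s It Is.
have one u f : rint (fun y => f y * cst 1 y) u = rint f u.
  by apply: eq_Rintegral => y _; rewrite mulr1.
pose q x := rint (fun y => Lab (x, y)) t.
have cq : continuous q by exact: (rint_cont (ckern_swap cLab) It).
(* The defect of the claim as a function of x. By Fubini its integral over every [-1, u] vanishes,
   and it is continuous, so it is zero. *)
pose g x := La (x, t) + ((-1) * La (x, -1) + (-1) * q x).
have cg : continuous g.
  move=> x; apply: cvgD; first exact: ckern_cont1.
  by apply: cvgD; apply: cvgMr; [exact: ckern_cont1|exact: cq].
have g0 x : I x -> g x = 0.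
  apply: rint_eq0 => // u Iu.
  rewrite rintD//; [|exact: ckern_int1|]; last first.
    by apply: rintegrableD; apply: rintegrableZ; [exact: ckern_int1|exact: rintegrable_continuous].
  rewrite rintD//; [|by apply: rintegrableZ; exact: ckern_int1|by apply: rintegrableZ; exact: rintegrable_continuous].
  rewrite !rintZ//; [|exact: rintegrable_continuous|exact: ckern_int1].
  have -> : rint q u = rint (fun y => rint (fun x => Lab (x, y)) u) t.
    transitivity (rint (fun x => rint (fun y => Lab (x, y) * cst 1 y) t) u).
      by apply: eq_Rintegral => y _; rewrite one.
    rewrite rint_Fubini//; last exact: rintegrable_cst.
    by apply: eq_Rintegral => y _; rewrite mul1r.
  have -> : rint (fun y => rint (fun x => Lab (x, y)) u) t =
      rint (fun y => Lb (u, y) + (-1) * Lb (-1, y)) t.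
    by apply: eq_rint => // y Iy; rewrite (hLb u y)//; ring.
  rewrite rintD//; [|exact: ckern_int2|by apply: rintegrableZ; exact: ckern_int2].
  rewrite rintZ//; last exact: ckern_int2.
  have e1 := hLa u t Iu It; have e2 := hLa u (-1) Iu (Iset_m1 R).
  have /= e3 := hL t u It Iu; have /= e4 := hL t (-1) It (Iset_m1 R).
  lra.
by have := g0 s Is; rewrite /g /q; lra.
Qed.

(** The chain rule along the diagonal without differentiability in two variables: integrating [Lab]
    over a triangle in both orders expresses the integral of La(x,x) + Lb(x,x) through L(s,s) and
    L(-1,-1). *)
Lemma primkern_diag (L La Lb Lab : R * R -> R) :
  primkern L La -> primkern Lb Lab ->
  primkern (fun p => L (p.2, p.1)) (fun p => Lb (p.2, p.1)) ->
  rprim (fun s => L (s, s)) (fun s => La (s, s) + Lb (s, s)).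
Proof.
move=> pL pLb pL'; have [_ _ /= hLa'] := primkern_swap pL pLb pL'.
have [cL cLa hLa] := pL; have [cLb cLab hLb] := pLb; have [_ _ /= hL] := pL'.
have d2 (D : R * R -> R) : ckern D -> rL2 (fun s => D (s, s)).
  move=> cD; have [_ [M hM]] := cD.
  apply: (@rL2_bounded _ _ (M ^+ 2)); first exact: ckern_diag_meas.
  by move=> x _; exact: sqr_le_norm.
split; first by apply: rL2D; exact: d2.
move=> s Is; rewrite rintD//; [|by apply: rL2_int; exact: d2|by apply: rL2_int; exact: d2].
have one f u v : \int[mu]_(x in `[u, v]) (f x * cst 1 x) = \int[mu]_(x in `[u, v]) f x.
  by apply: eq_Rintegral => y _; rewrite mulr1.
have [_ [M hM]] := cLab.
have := @rint_triangle _ (fun p => Lab (p.2, p.1)) (cst 1) (cst 1) M s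
  (continuous2_measurable (ckern_swap cLab).1) (fun p => hM _) (rintegrable_cst 1) (rintegrable_cst 1) Is.
have -> : rint (fun x => cst 1 x * rint (fun t => Lab (t, x) * cst 1 t) x) s =
    rint (fun x => Lb (x, x) + (-1) * Lb (-1, x)) s.
  apply: eq_rint => // x Ix; rewrite mul1r /rint one -/(rint _ _) (hLb x x)//; ring.
have -> : rint (fun t => cst 1 t * \int[mu]_(x in `[t, s]) (Lab (t, x) * cst 1 x)) s =
    rint (fun x => La (x, s) + (-1) * La (x, x)) s.
  apply: eq_Rintegral => x; rewrite inE /= => hx.
  have Ix : I x by exact: (subI Is).
  rewrite mul1r one rintB_itv//; last 2 first.
  - by move: hx; rewrite in_itv /= => /andP[].
  - exact: ckern_int2.
  by rewrite (hLa' s x)// (hLa' x x)//; ring.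
have iD (D : R * R -> R) : ckern D -> rintegrable (fun s => D (s, s)) by move=> /d2 /rL2_int.
rewrite rintD//; [|exact: iD|by apply: rintegrableZ; exact: ckern_int2].
rewrite rintD//; [|exact: ckern_int1|by apply: rintegrableZ; exact: iD].
rewrite !rintZ//; [|exact: iD|exact: ckern_int2].
have e1 := hLa s s Is Is; have e2 := hL s (-1) Is (Iset_m1 R).
lra.
Qed.

End RealVolterra.

(** * Exponentials, smoothing at scale 1/k, and kernels with classical derivatives *)

Section RealSmooth.
Variable R : realType.
Local Notation I := (@Iset R).
Hint Resolve measurable_IsetR Iset_m1 Iset_1 measurable_Iset : core.

Lemma rprim_C1 (F f : R -> R) : continuous F -> continuous f ->
  (forall x, is_derive x (1 : R) F (f x)) -> rprim F f.
Proof.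
move=> cF cf dF; split; last by move=> s Is; apply: FTC_Iset.
have mf : measurable_fun I f.
  by apply: (@measurable_funS _ _ _ _ setT) => //; exact: continuous_measurable_fun.
apply: (rL2_le mf (g := fun x => f x ^+ 2)) => //.
by apply: rintegrable_continuous => x; apply: cvgM; exact: cf.
Qed.

Lemma is_derive_scale_comp (F f : R -> R) c : (forall x, is_derive x (1 : R) F (f x)) ->
  forall x, is_derive x (1 : R) (fun y => F (c * y)) (c * f (c * x)).
Proof.
move=> dF x.
have h : is_derive x (1 : R) (fun y : R => c * y) c.
  have := @is_deriveZ _ _ _ id c x (1 : R) 1 (is_derive_id x 1).
  by rewrite /GRing.scale /= mulr1.
by have := @is_derive1_comp _ F (fun y => c * y) x (f (c * x)) c (dF _) h; rewrite mulrC.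
Qed.

Lemma continuous_scale_comp (F : R -> R) c : continuous F -> continuous (fun y : R => F (c * y)).
Proof.
move=> cF x; have h : (c * y) @[y --> x] --> c * x by apply: cvgMr; exact: cvg_id.
exact: (cvg_comp _ _ h (cF _)).
Qed.

Lemma rprim_expR c : rprim (fun x : R => expR (c * x)) (fun x => c * expR (c * x)).
Proof.
have ce := @continuous_scale_comp _ c (@continuous_expR R).
apply: rprim_C1 => //.
- by move=> x; apply: cvgMr; exact: ce.
- by move=> x; apply: (@is_derive_scale_comp expR expR).
Qed.

Lemma rprim_cos c : rprim (fun x : R => cos (c * x)) (fun x => - c * sin (c * x)).
Proof.
apply: rprim_C1 => //.
- exact: (@continuous_scale_comp _ c (@continuous_cos R)).
- by move=> x; apply: cvgMr; exact: (@continuous_scale_comp _ c (@continuous_sin R)).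
- move=> x; rewrite mulNr -mulrN.
  exact: (@is_derive_scale_comp cos (fun x => - sin x)).
Qed.

Lemma rprim_sin c : rprim (fun x : R => sin (c * x)) (fun x => c * cos (c * x)).
Proof.
apply: rprim_C1 => //.
- exact: (@continuous_scale_comp _ c (@continuous_sin R)).
- by move=> x; apply: cvgMr; exact: (@continuous_scale_comp _ c (@continuous_cos R)).
- by move=> x; exact: (@is_derive_scale_comp sin cos).
Qed.

(** The solution of y + y'/k = f with y(-1) = 0. *)
Definition rsmooth (k : R) (f : R -> R) (s : R) : R :=
  k * (expR (- k * s) * rint (fun t => expR (k * t) * f t) s).

Lemma rprim_rsmooth k f : rL2 f -> rprim (rsmooth k f) (fun s => k * (f s - rsmooth k f s)).
Proof.
move=> hf.
have [M hM] := rprim_bounded (rprim_expR k).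
have hef : rL2 (fun t => expR (k * t) * f t).
  by apply: (@rL2_mul_bounded _ _ _ M) => //; exact: rprim_meas (rprim_expR k).
have := rprimZ k (rprimM (rprim_expR (- k)) (rprim_rint hef)).
apply: eq_rprim => // s Is; rewrite /rsmooth.
have e : expR (- k * s) * expR (k * s) = 1 by rewrite -expRD mulNr addNr expR0.
by rewrite [X in _ * (_ + X)]mulrA e; ring.
Qed.

(* With [y' = k (f - y)] and [y (-1) = 0], integrating [(y ^ 2)' = 2 y y'] gives
   [\int y ^ 2 <= \int f y]. *)
Lemma rsmooth_L2_le (k : R) f : 0 < k -> rL2 f ->
  rint (fun s => rsmooth k f s ^+ 2) 1 <= rint (fun s => f s ^+ 2) 1.
Proof.
move=> k0 hf; have pY := rprim_rsmooth k hf.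
set Y := rsmooth k f in pY *.
have hY := rprim_L2 pY.
have [_ /(_ 1 (Iset_1 R))] := rprimM pY pY.
have -> : Y (-1) = 0 by rewrite /Y /rsmooth rint_m1 !mulr0.
rewrite mulr0 add0r => E.
have E2 : rint (fun x => k * (f x - Y x) * Y x + Y x * (k * (f x - Y x))) 1 =
    2 * k * (rint (fun x => f x * Y x) 1 - rint (fun x => Y x ^+ 2) 1).
  have ify := rL2M hf hY; have iyy := hY.2.
  rewrite mulrBr -rintZ// -mulNr -rintZ -?rintD//.
  - by apply: eq_rint => // x _; ring.
  - exact: rintegrableZ.
  - exact: rintegrableZ.
have h1 : rint (fun x => f x * Y x) 1 <= rint (fun x => 2^-1 * f x ^+ 2 + 2^-1 * Y x ^+ 2) 1.
  apply: rint_le => //; first exact: rL2M.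
    by apply: rintegrableD; apply: rintegrableZ; [case: hf|case: hY].
  by move=> x _; have := sqr_ge0 (f x - Y x); rewrite !expr2; lra.
rewrite rintD// ?rintZ// in h1; try by [case: hf|case: hY]; last 2 first.
- by apply: rintegrableZ; case: hf.
- by apply: rintegrableZ; case: hY.
have h0 : 0 <= Y 1 * Y 1 by rewrite -expr2 sqr_ge0.
rewrite E E2 pmulr_rge0 in h0; last by rewrite mulr_gt0.
lra.
Qed.

(** For interior t this is the fundamental theorem of calculus, which asks for the derivative at
    interior s only; both sides are continuous in t, so the identity extends to t = -1 and t = 1. *)
Lemma primkern_derive (L La : R -> R -> R) :
  ckern (fun p => L (clamp p.1) (clamp p.2)) -> ckern (fun p => La (clamp p.1) (clamp p.2)) ->
  (forall s t, @Iopen R s -> @Iopen R t -> is_derive s (1 : R) (fun x => L x t) (La s t)) ->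
  primkern (fun p => L (clamp p.1) (clamp p.2)) (fun p => La (clamp p.1) (clamp p.2)).
Proof.
move=> cL cLa dL; split => // s t Is It /=.
have sub x : @Iopen R x -> I x by exact: subset_itv_oo_cc.
pose g t := L (clamp s) (clamp t) + ((-1) * L (clamp (-1)) (clamp t)
  + (-1) * rint (fun x => La (clamp x) (clamp t)) s).
suff g0 : g t = 0 by move: g0; rewrite /g; lra.
apply: (@cont_eq0 _ g) It.
  move=> y _; apply: cvgD; first exact: (@ckern_cont2 _ _ s cL y).
  apply: cvgD; apply: cvgMr; first exact: (@ckern_cont2 _ _ (-1) cL y).
  by have := @rint_cont _ _ s cLa Is y.
move=> {}t ot; rewrite /g.
have dc x : @Iopen R x ->
    is_derive x (1 : R) (fun x => L (clamp x) (clamp t)) (La (clamp x) (clamp t)).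
  move=> ox; rewrite (clamp_id (sub _ ox)) (clamp_id (sub _ ot)).
  apply: near_eq_is_derive (dL x t ox ot).
  near=> y; rewrite clamp_id//; apply: sub.
  near: y; exact: near_in_itvoo.
have -> := @FTC_Iset R (fun x => L (clamp x) (clamp t)) (fun x => La (clamp x) (clamp t))
  (@ckern_cont1 _ _ t cL) (@ckern_cont1 _ _ t cLa) dc s Is.
by ring.
Unshelve. all: by end_near. Qed.

End RealSmooth.

(** * Complex-valued primitives and squared norms *)

Section ComplexPrimitive.
Variable R : realType.
Local Notation C := R[i].
Local Notation I := (@Iset R).
Hint Resolve measurable_IsetR Iset_m1 Iset_1 measurable_Iset : core.

Lemma complex_ext (x y : C) : complex.Re x = complex.Re y -> complex.Im x = complex.Im y -> x = y.
Proof. by case: x => a b; case: y => c d /= -> ->. Qed.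
Lemma Re_add (x y : C) : @complex.Re R (x + y) = complex.Re x + complex.Re y.
Proof. by case: x => a b; case: y. Qed.
Lemma Im_add (x y : C) : @complex.Im R (x + y) = complex.Im x + complex.Im y.
Proof. by case: x => a b; case: y. Qed.
Lemma Re_mul (x y : C) : @complex.Re R (x * y) =
  complex.Re x * complex.Re y - complex.Im x * complex.Im y.
Proof. by case: x => a b; case: y. Qed.
Lemma Im_mul (x y : C) : @complex.Im R (x * y) =
  complex.Re x * complex.Im y + complex.Im x * complex.Re y.
Proof. by case: x => a b; case: y. Qed.

Lemma cabs2M (x y : C) : cabs2 (x * y) = cabs2 x * cabs2 y.
Proof. by rewrite /cabs2 Re_mul Im_mul; ring. Qed.
Lemma cabs2D (x y : C) : cabs2 (x + y) <= 2 * cabs2 x + 2 * cabs2 y.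
Proof.
rewrite /cabs2 Re_add Im_add; have := sqrrD_le (complex.Re x) (complex.Re y).
by have := sqrrD_le (complex.Im x) (complex.Im y); lra.
Qed.
Lemma cabs2_ge0 (x : C) : 0 <= cabs2 x.
Proof. by rewrite addr_ge0 ?sqr_ge0. Qed.

Lemma cabs2_expi x : cabs2 (expi x : C) = 1.
Proof. exact: cos2Dsin2. Qed.
Lemma expiD (x y : R) : expi (x + y) = expi x * expi y :> C.
Proof. by apply: complex_ext; rewrite ?Re_mul ?Im_mul /= ?cosD ?sinD//; ring. Qed.
Lemma expi0 : expi 0 = 1 :> C.
Proof. by apply: complex_ext; rewrite /= ?cos0 ?sin0. Qed.
Lemma L2IP (f : R -> C) : L2I f <-> rL2 (ReF f) /\ rL2 (ImF f).
Proof.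
split=> [[mr [mi hf]]|[[mr hr] [mi hi]]].
  have icf : rintegrable (fun x => cabs2 (f x)).
    apply/integrableP; split.
      by apply: measurable_EFin_IsetR; apply: measurable_funD; exact: measurable_funX.
    by under eq_integral do rewrite /= ger0_norm ?cabs2_ge0//.
  by split; apply: (rL2_le _ icf) => // x _; rewrite /cabs2 ?lerDl ?lerDr sqr_ge0.
split => //; split => //.
have := integrable_lty (@measurable_IsetR R) (rintegrableD hr hi).
by [].
Qed.

Lemma rintegrable_cabs2 (f : R -> C) : L2I f -> rintegrable (fun x => cabs2 (f x)).
Proof. by move=> /L2IP [[_ h1] [_ h2]]; exact: rintegrableD. Qed.

Lemma L2sqE (f : R -> C) : L2sq f = rint (fun x => cabs2 (f x)) 1.
Proof. by []. Qed.

Lemma cint_m1 (f : R -> C) : cint `[(-1 : R), (-1)] f = 0.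
Proof. by apply: complex_ext; rewrite /cint /= set_itv1 Rintegral_set1. Qed.

Definition cprim (F f : R -> C) :=
  L2I f /\ forall s, I s -> F s = F (-1) + cint `[(-1 : R), s] f.

Lemma cprimP F f : cprim F f <-> rprim (ReF F) (ReF f) /\ rprim (ImF F) (ImF f).
Proof.
split=> [[/L2IP [h1 h2] hF]|[[h1 hR] [h2 hI]]].
  by split; split => // s Is; rewrite /ReF /ImF hF// ?Re_add ?Im_add.
split; first by apply/L2IP.
by move=> s Is; apply: complex_ext; rewrite ?Re_add ?Im_add; [exact: hR|exact: hI].
Qed.

Lemma eq_L2I (f g : R -> C) : (forall x, I x -> f x = g x) -> L2I f -> L2I g.
Proof.
move=> fg /L2IP [h1 h2]; apply/L2IP.
by split; [apply: eq_rL2 h1|apply: eq_rL2 h2] => x Ix; rewrite /ReF /ImF fg.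
Qed.

Lemma L2ID (f g : R -> C) : L2I f -> L2I g -> L2I (fun x => f x + g x).
Proof.
move=> /L2IP [f1 f2] /L2IP [g1 g2]; apply/L2IP; split.
- by apply: eq_rL2 (rL2D f1 g1) => x _; rewrite /ReF Re_add.
- by apply: eq_rL2 (rL2D f2 g2) => x _; rewrite /ImF Im_add.
Qed.

Definition cmeas (f : R -> C) := measurable_fun I (ReF f) /\ measurable_fun I (ImF f).

Lemma L2IM_bounded (g f : R -> C) M : cmeas g -> (forall x, I x -> cabs2 (g x) <= M) ->
  L2I f -> L2I (fun x => g x * f x).
Proof.
move=> [g1 g2] gM hf; have /L2IP [[f1 _] [f2 _]] := hf; have icf := rintegrable_cabs2 hf.
have h x : I x -> cabs2 (g x * f x) <= M * cabs2 (f x).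
  by move=> Ix; rewrite cabs2M ler_wpM2r ?cabs2_ge0//; exact: gM.
apply/L2IP; split; apply: (rL2_le _ (rintegrableZ M icf)).
- apply: (@eq_measurable_fun _ _ _ _ _ (fun x => ReF g x * ReF f x - ImF g x * ImF f x)).
    by move=> x _; rewrite /ReF Re_mul.
  by apply: measurable_funB; exact: measurable_funM.
- by move=> x Ix; apply: le_trans (h x Ix); rewrite /cabs2 lerDl sqr_ge0.
- apply: (@eq_measurable_fun _ _ _ _ _ (fun x => ReF g x * ImF f x + ImF g x * ReF f x)).
    by move=> x _; rewrite /ImF Im_mul.
  by apply: measurable_funD; exact: measurable_funM.
- by move=> x Ix; apply: le_trans (h x Ix); rewrite /cabs2 lerDr sqr_ge0.
Qed.

Lemma cmeas_cst c : cmeas (fun=> c).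
Proof. by split; exact: measurable_cst. Qed.

Definition nb (f : R -> C) (B : R) := L2I f /\ L2sq f <= B.

Lemma nb_le f A B : A <= B -> nb f A -> nb f B.
Proof. by move=> AB [hf h]; split => //; exact: le_trans AB. Qed.

Lemma nb_ge0 f B : nb f B -> 0 <= B.
Proof. by move=> [hf]; apply: le_trans; rewrite L2sqE; apply: rint_ge0 => // x _; exact: cabs2_ge0. Qed.

Lemma eq_nb f g B : (forall x, I x -> f x = g x) -> nb f B -> nb g B.
Proof.
move=> fg [hf h]; split; first exact: eq_L2I hf.
by move: h; rewrite !L2sqE (@eq_rint _ _ (fun x => cabs2 (g x)))// => x Ix; rewrite fg.
Qed.

Lemma nb_pointwise f (g : R -> R) B : L2I f -> rintegrable g ->
  (forall x, I x -> cabs2 (f x) <= g x) -> rint g 1 <= B -> nb f B.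
Proof.
move=> hf hg fg gB; split => //; rewrite L2sqE; apply: le_trans gB.
by apply: rint_le => //; exact: rintegrable_cabs2.
Qed.

Lemma nbD f g A B : nb f A -> nb g B -> nb (fun x => f x + g x) (2 * A + 2 * B).
Proof.
move=> [hf fA] [hg gB]; have i1 := rintegrable_cabs2 hf; have i2 := rintegrable_cabs2 hg.
apply: (@nb_pointwise _ (fun x => 2 * cabs2 (f x) + 2 * cabs2 (g x))).
- exact: L2ID.
- by apply: rintegrableD; exact: rintegrableZ.
- by move=> x _; exact: cabs2D.
rewrite rintD// ?rintZ//; try exact: rintegrableZ.
by move: fA gB; rewrite !L2sqE; lra.
Qed.

Lemma nbM_bounded g f M B : 0 <= M -> cmeas g -> (forall x, I x -> cabs2 (g x) <= M) -> nb f B ->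
  nb (fun x => g x * f x) (M * B).
Proof.
move=> M0 mg gM [hf fB]; have i1 := rintegrable_cabs2 hf.
apply: (@nb_pointwise _ (fun x => M * cabs2 (f x))).
- exact: L2IM_bounded mg gM hf.
- exact: rintegrableZ.
- by move=> x Ix; rewrite cabs2M ler_wpM2r ?cabs2_ge0//; exact: gM.
by rewrite rintZ// ler_wpM2l.
Qed.

Lemma nbZ c f B : nb f B -> nb (fun x => c * f x) (cabs2 c * B).
Proof. by apply: nbM_bounded; [exact: cabs2_ge0|exact: cmeas_cst|]. Qed.

Lemma nb_bounded f M : cmeas f -> (forall x, I x -> cabs2 (f x) <= M) -> nb f (2 * M).
Proof.
move=> [m1 m2] fM.
have hf : L2I f.
  apply/L2IP; split; apply: (rL2_le _ (rintegrable_cst M)) => // x Ix; apply: le_trans (fM x Ix).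
  - by rewrite /cabs2 lerDl sqr_ge0.
  - by rewrite /cabs2 lerDr sqr_ge0.
apply: (nb_pointwise hf (rintegrable_cst M)) => //.
by rewrite rint_cst//; lra.
Qed.

Lemma cabs2_cint_le f B s : I s -> nb f B -> cabs2 (cint `[(-1 : R), s] f) <= 2 * B.
Proof.
move=> Is [/L2IP [h1 h2]]; rewrite L2sqE => hB.
have := rint_CS Is h1; have := rint_CS Is h2.
have : rint (fun x => cabs2 (f x)) 1 = rint (fun x => ReF f x ^+ 2) 1 + rint (fun x => ImF f x ^+ 2) 1.
  by apply: rintD => //; [case: h1|case: h2].
by move=> E; rewrite E in hB; rewrite /cabs2 /cint /= -!/(rint _ _); lra.
Qed.

Lemma cprim_cint f : L2I f -> cprim (fun s => cint `[(-1 : R), s] f) f.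
Proof. by move=> /L2IP [h1 h2]; apply/cprimP; split; exact: rprim_rint. Qed.

Lemma cprim_cmeas F f : cprim F f -> cmeas F.
Proof. by move=> /cprimP [h1 h2]; split; [exact: rprim_meas h1|exact: rprim_meas h2]. Qed.

Lemma cprim_L2I F f : cprim F f -> L2I F.
Proof. by move=> /cprimP [h1 h2]; apply/L2IP; split; [exact: rprim_L2 h1|exact: rprim_L2 h2]. Qed.

Lemma nb_cint f B : nb f B -> nb (fun s => cint `[(-1 : R), s] f) (4 * B).
Proof.
move=> hf; have -> : 4 * B = 2 * (2 * B) by ring.
apply: nb_bounded; first exact: cprim_cmeas (cprim_cint hf.1).
by move=> s Is; exact: cabs2_cint_le.
Qed.

(** A trace estimate: |F(-1)|^2 <= 2 |F(x)|^2 + 4 B for every x in I, and averaging over I gives the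
    constants. *)
Lemma cprim_start F f A B : cprim F f -> nb F A -> nb f B -> cabs2 (F (-1)) <= A + 4 * B.
Proof.
move=> [hf hF] [hFA nF] nf; have B0 := nb_ge0 nf; have icF := rintegrable_cabs2 hFA.
have : rint (cst (cabs2 (F (-1)))) 1 <= rint (fun x => 2 * cabs2 (F x) + cst (4 * B) x) 1.
  apply: rint_le => //; first exact: rintegrable_cst.
    by apply: rintegrableD; [exact: rintegrableZ|exact: rintegrable_cst].
  move=> x Ix /=; have -> : F (-1) = F x + (-1) * cint `[(-1 : R), x] f by rewrite (hF x Ix); ring.
  apply: (le_trans (cabs2D _ _)); rewrite cabs2M.
  have -> : cabs2 (-1 : C) = 1 by rewrite /cabs2 /=; ring.
  by have := cabs2_cint_le Ix nf; lra.
rewrite [X in _ <= X]rintD//; [|exact: rintegrableZ|exact: rintegrable_cst].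
by rewrite rintZ// !rint_cst//; move: nF; rewrite L2sqE; lra.
Qed.

Lemma eq_cprim F f G g : (forall x, I x -> F x = G x) -> (forall x, I x -> f x = g x) ->
  cprim F f -> cprim G g.
Proof.
move=> FG fg /cprimP [h1 h2]; apply/cprimP.
by split; [apply: eq_rprim h1|apply: eq_rprim h2] => x Ix; rewrite /ReF /ImF ?FG ?fg.
Qed.

Lemma cprimD F f G g : cprim F f -> cprim G g ->
  cprim (fun x => F x + G x) (fun x => f x + g x).
Proof.
move=> /cprimP [f1 f2] /cprimP [g1 g2]; apply/cprimP; split.
- by apply: eq_rprim (rprimD f1 g1) => x _; rewrite /ReF Re_add.
- by apply: eq_rprim (rprimD f2 g2) => x _; rewrite /ImF Im_add.
Qed.

Lemma cprimM F f G g : cprim F f -> cprim G g ->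
  cprim (fun x => F x * G x) (fun x => f x * G x + F x * g x).
Proof.
move=> /cprimP [f1 f2] /cprimP [g1 g2]; apply/cprimP; split.
- apply: eq_rprim (rprimD (rprimM f1 g1) (rprimZ (-1) (rprimM f2 g2))) => x _.
    by rewrite /ReF Re_mul /ImF; ring.
  by rewrite /ReF Re_add !Re_mul /ImF; ring.
- apply: eq_rprim (rprimD (rprimM f1 g2) (rprimM f2 g1)) => x _.
    by rewrite /ImF Im_mul.
  by rewrite /ImF Im_add !Im_mul /ReF; ring.
Qed.

Lemma rprim_cst c : rprim (fun=> c : R) (fun=> 0).
Proof.
split; first exact: rL2_cst.
by move=> s Is; rewrite (@rint_cst _ 0)// mul0r addr0.
Qed.

Lemma cprim_cst c : cprim (fun=> c) (fun=> 0).
Proof. by apply/cprimP; split; exact: rprim_cst. Qed.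

Lemma cprimZ c F f : cprim F f -> cprim (fun x => c * F x) (fun x => c * f x).
Proof. by move=> h; apply: eq_cprim (cprimM (cprim_cst c) h) => x _ //; rewrite mul0r add0r. Qed.

Lemma cprim_expi (c : R) : cprim (fun x => expi (c * x)) (fun x => Complex 0 c * expi (c * x)).
Proof.
apply/cprimP; split.
- by apply: eq_rprim (rprim_cos c) => x _ //; rewrite /ReF Re_mul /=; ring.
- by apply: eq_rprim (rprim_sin c) => x _ //; rewrite /ImF Im_mul /=; ring.
Qed.

Definition cprimkern (L La : R -> R -> C) :=
  primkern (fun p => complex.Re (L p.1 p.2)) (fun p => complex.Re (La p.1 p.2)) /\
  primkern (fun p => complex.Im (L p.1 p.2)) (fun p => complex.Im (La p.1 p.2)).

Definition cckern (L : R -> R -> C) :=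
  ckern (fun p => complex.Re (L p.1 p.2)) /\ ckern (fun p => complex.Im (L p.1 p.2)).

Lemma Re_cint_kernel L x s phi : cckern L -> L2I phi -> I s ->
  rint (ReF (fun t => L x t * phi t)) s =
  rint (fun t => complex.Re (L x t) * ReF phi t) s
    + (-1) * rint (fun t => complex.Im (L x t) * ImF phi t) s.
Proof.
move=> [k1 k2] /L2IP [/rL2_int i1 /rL2_int i2] Is.
have j1 := @ckern_intM _ _ _ x k1 i1; have j2 := @ckern_intM _ _ _ x k2 i2.
rewrite -rintZ// -rintD//; last exact: rintegrableZ.
by apply: eq_rint => // t _; rewrite /ReF Re_mul /ImF; ring.
Qed.

Lemma Im_cint_kernel L x s phi : cckern L -> L2I phi -> I s ->
  rint (ImF (fun t => L x t * phi t)) s =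
  rint (fun t => complex.Re (L x t) * ImF phi t) s
    + rint (fun t => complex.Im (L x t) * ReF phi t) s.
Proof.
move=> [k1 k2] /L2IP [/rL2_int i1 /rL2_int i2] Is.
have j1 := @ckern_intM _ _ _ x k1 i2; have j2 := @ckern_intM _ _ _ x k2 i1.
by rewrite -rintD//; apply: eq_rint => // t _; rewrite /ImF Im_mul /ReF; ring.
Qed.

Lemma cprim_volterra L La phi : cprimkern L La -> L2I phi ->
  cprim (fun s => cint `[(-1 : R), s] (fun t => L s t * phi t))
        (fun s => L s s * phi s + cint `[(-1 : R), s] (fun t => La s t * phi t)).
Proof.
move=> [p1 p2] hphi; have /L2IP [h1 h2] := hphi.
have [c1 d1 _] := p1; have [c2 d2 _] := p2.
have kL : cckern L by []; have kLa : cckern La by [].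
apply/cprimP; split.
- apply: eq_rprim (rprimD (rprim_volterra p1 h1) (rprimZ (-1) (rprim_volterra p2 h2))) => s Is.
    by rewrite [RHS]/ReF /= -/(rint _ _) Re_cint_kernel.
  by rewrite [RHS]/ReF Re_add Re_mul /= -/(rint _ _) Re_cint_kernel// /ReF /ImF; ring.
- apply: eq_rprim (rprimD (rprim_volterra p1 h2) (rprim_volterra p2 h1)) => s Is.
    by rewrite [RHS]/ImF /= -/(rint _ _) Im_cint_kernel.
  by rewrite [RHS]/ImF Im_add Im_mul /= -/(rint _ _) Im_cint_kernel// /ReF /ImF; ring.
Qed.

Lemma cprim_fixed L La phi : cprimkern L La -> L2I phi ->
  cprim (fun s => cint I (fun t => L s t * phi t)) (fun s => cint I (fun t => La s t * phi t)).
Proof.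
move=> [p1 p2] hphi; have /L2IP [h1 h2] := hphi.
have [c1 d1 _] := p1; have [c2 d2 _] := p2.
have kL : cckern L by []; have kLa : cckern La by [].
apply/cprimP; split.
- apply: eq_rprim (rprimD (rprim_fixed p1 h1) (rprimZ (-1) (rprim_fixed p2 h2))) => s Is.
    by rewrite [RHS]/ReF /= -/(rint _ 1) Re_cint_kernel.
  by rewrite [RHS]/ReF /= -/(rint _ 1) Re_cint_kernel.
- apply: eq_rprim (rprimD (rprim_fixed p1 h2) (rprim_fixed p2 h1)) => s Is.
    by rewrite [RHS]/ImF /= -/(rint _ 1) Im_cint_kernel.
  by rewrite [RHS]/ImF /= -/(rint _ 1) Im_cint_kernel.
Qed.

Lemma cmeas_volterra L phi : cckern L -> L2I phi ->
  cmeas (fun s => cint `[(-1 : R), s] (fun t => L s t * phi t)).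
Proof.
move=> kL hphi; have [k1 k2] := kL; have /L2IP [/rL2_int i1 /rL2_int i2] := hphi.
have v (K : R * R -> R) psi : ckern K -> rintegrable psi ->
    measurable_fun I (fun s => rint (fun t => K (s, t) * psi t) s).
  by move=> kK hpsi; apply: rintegrable_meas; exact: rint_volterra_int.
split.
- apply: (@eq_measurable_fun _ _ _ _ _ (fun s =>
    rint (fun t => complex.Re (L s t) * ReF phi t) s
    + (-1) * rint (fun t => complex.Im (L s t) * ImF phi t) s)).
    by move=> s; rewrite inE => Is; rewrite [RHS]/ReF /= -/(rint _ _) Re_cint_kernel.
  apply: measurable_funD; first exact: v k1 i1.
  by apply: measurable_funM => //; exact: v k2 i2.
- apply: (@eq_measurable_fun _ _ _ _ _ (fun s =>
    rint (fun t => complex.Re (L s t) * ImF phi t) s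
    + rint (fun t => complex.Im (L s t) * ReF phi t) s)).
    by move=> s; rewrite inE => Is; rewrite [RHS]/ImF /= -/(rint _ _) Im_cint_kernel.
  by apply: measurable_funD; [exact: v k1 i2|exact: v k2 i1].
Qed.

Lemma cmeas_fixed L phi : cckern L -> L2I phi -> cmeas (fun s => cint I (fun t => L s t * phi t)).
Proof.
move=> kL hphi; have [k1 k2] := kL; have /L2IP [/rL2_int i1 /rL2_int i2] := hphi.
have v (K : R * R -> R) psi : ckern K -> rintegrable psi ->
    measurable_fun I (fun s => rint (fun t => K (s, t) * psi t) 1).
  by move=> kK hpsi; apply: rintegrable_meas; exact: rint_fixed_int.
split.
- apply: (@eq_measurable_fun _ _ _ _ _ (fun s =>
    rint (fun t => complex.Re (L s t) * ReF phi t) 1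
    + (-1) * rint (fun t => complex.Im (L s t) * ImF phi t) 1)).
    by move=> s; rewrite inE => Is; rewrite [RHS]/ReF /= -/(rint _ 1) Re_cint_kernel.
  apply: measurable_funD; first exact: v k1 i1.
  by apply: measurable_funM => //; exact: v k2 i2.
- apply: (@eq_measurable_fun _ _ _ _ _ (fun s =>
    rint (fun t => complex.Re (L s t) * ImF phi t) 1
    + rint (fun t => complex.Im (L s t) * ReF phi t) 1)).
    by move=> s; rewrite inE => Is; rewrite [RHS]/ImF /= -/(rint _ 1) Im_cint_kernel.
  by apply: measurable_funD; [exact: v k1 i2|exact: v k2 i1].
Qed.

Lemma cckern_bounded L : cckern L -> exists N, 0 <= N /\ forall s t, cabs2 (L s t) <= N.
Proof.
move=> [[_ [M1 h1]] [_ [M2 h2]]]; exists (M1 ^+ 2 + M2 ^+ 2); split.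
  by rewrite addr_ge0 ?sqr_ge0.
by move=> s t; apply: lerD; apply: sqr_le_norm; [exact: h1 (s, t)|exact: h2 (s, t)].
Qed.

Lemma nb_kernelM L phi N B s : cckern L -> 0 <= N -> (forall s t, cabs2 (L s t) <= N) -> nb phi B ->
  nb (fun t => L s t * phi t) (N * B).
Proof.
move=> [k1 k2] N0 hN; apply: nbM_bounded => //.
by split; [exact: (@ckern_meas2 _ _ s k1)|exact: (@ckern_meas2 _ _ s k2)].
Qed.

Lemma nb_volterra L phi N B : cckern L -> 0 <= N -> (forall s t, cabs2 (L s t) <= N) -> nb phi B ->
  nb (fun s => cint `[(-1 : R), s] (fun t => L s t * phi t)) (4 * (N * B)).
Proof.
move=> kL N0 hN hphi; rewrite (_ : 4 * _ = 2 * (2 * (N * B))); last by ring.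
apply: nb_bounded; first exact: cmeas_volterra hphi.1.
by move=> s Is; apply: cabs2_cint_le => //; exact: nb_kernelM.
Qed.

Lemma nb_fixed L phi N B : cckern L -> 0 <= N -> (forall s t, cabs2 (L s t) <= N) -> nb phi B ->
  nb (fun s => cint I (fun t => L s t * phi t)) (4 * (N * B)).
Proof.
move=> kL N0 hN hphi; rewrite (_ : 4 * _ = 2 * (2 * (N * B))); last by ring.
apply: nb_bounded; first exact: cmeas_fixed hphi.1.
by move=> s Is; apply: (@cabs2_cint_le _ _ 1) => //; exact: nb_kernelM.
Qed.

End ComplexPrimitive.

(** * Amplitudes with weighted derivatives *)

Section Weighted.
Variable R : realType.
Local Notation C := R[i].
Local Notation I := (@Iset R).
Hint Resolve measurable_IsetR Iset_m1 Iset_1 measurable_Iset : core.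

(** Derivatives are quantified level by level, so that every operation on amplitudes is treated by
    exhibiting one derivative and recursing. [w j] bounds the squared norm of the j-th
    derivative. *)
Fixpoint W (q : nat) (w : nat -> R) (f : R -> C) : Prop :=
  nb f (w 0%N) /\
  match q with
  | 0%N => True
  | q'.+1 => exists f', cprim f f' /\ W q' (fun j => w j.+1) f'
  end.

(** The class of multipliers. Bounds are uniform because a product of two L^2 functions need not be
    in L^2. *)
Fixpoint bsmooth (q : nat) (N : R) (f : R -> C) : Prop :=
  cmeas f /\ (forall x, I x -> cabs2 (f x) <= N) /\
  match q with
  | 0%N => True
  | q'.+1 => exists f', cprim f f' /\ bsmooth q' N f'
  end.

Lemma W_nb q w f : W q w f -> nb f (w 0%N).
Proof. by case: q => [|q] []. Qed.

Lemma W_le q (w w' : nat -> R) f : (forall j, (j <= q)%N -> w j <= w' j) -> W q w f -> W q w' f.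
Proof.
elim: q w w' f => [|q IH] w w' f h /= [hf].
  by move=> _; split => //; apply: nb_le hf; exact: h.
move=> [f' [pf hf']]; split; first by apply: nb_le hf; exact: h.
by exists f'; split => //; apply: IH hf' => j jq; exact: h.
Qed.

Lemma eq_W q w f g : (forall x, I x -> f x = g x) -> W q w f -> W q w g.
Proof.
case: q => [|q] fg /= [hf]; first by move=> _; split => //; exact: eq_nb hf.
move=> [f' [pf hf']]; split; first exact: eq_nb hf.
by exists f'; split => //; exact: eq_cprim pf.
Qed.

Lemma W_down q q' w f : (q' <= q)%N -> W q w f -> W q' w f.
Proof.
elim: q' q w f => [|q' IH] [|q] w f //; first by move=> _ /= [].
move=> qq /= [hf [f' [pf hf']]]; split => //; exists f'; split => //.
exact: IH hf'.
Qed.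

Lemma W_ge0 q w f j : W q w f -> (j <= q)%N -> 0 <= w j.
Proof.
elim: q w f j => [|q IH] w f [|j] //= [hf]; try by move=> _ _; exact: nb_ge0 hf.
by move=> [f' [_ hf']] jq; exact: IH hf' _.
Qed.

Lemma WD q w w' f g : W q w f -> W q w' g ->
  W q (fun j => 2 * w j + 2 * w' j) (fun x => f x + g x).
Proof.
elim: q w w' f g => [|q IH] w w' f g /=; first by move=> [hf _] [hg _]; split => //; exact: nbD.
move=> [hf [f' [pf hf']]] [hg [g' [pg hg']]]; split; first exact: nbD.
by exists (fun x => f' x + g' x); split; [exact: cprimD|exact: IH].
Qed.

Lemma WZ q w c f : W q w f -> W q (fun j => cabs2 c * w j) (fun x => c * f x).
Proof.
elim: q w f => [|q IH] w f /=; first by move=> [hf _]; split => //; exact: nbZ.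
move=> [hf [f' [pf hf']]]; split; first exact: nbZ.
by exists (fun x => c * f' x); split; [exact: cprimZ|exact: IH].
Qed.

Lemma nb_cst c B : 2 * cabs2 c <= B -> nb (fun=> c : C) B.
Proof.
by move=> h; apply: (nb_le h); apply: nb_bounded => //; exact: cmeas_cst.
Qed.

Lemma W_cst q (w : nat -> R) c : 2 * cabs2 c <= w 0%N -> (forall j, 0 <= w j) -> W q w (fun=> c).
Proof.
elim: q w c => [|q IH] w c cw w0 /=; split => //; try exact: nb_cst.
exists (fun=> 0); split; first exact: cprim_cst.
by apply: IH => //; rewrite /cabs2 /= expr0n /= addr0 mulr0.
Qed.

Lemma W_zero q (w : nat -> R) : (forall j, 0 <= w j) -> W q w (fun=> 0).
Proof. by move=> w0; apply: W_cst => //; rewrite /cabs2 /= expr0n /= addr0 mulr0. Qed.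

Lemma W_cint q w f : W q w f ->
  W q.+1 (fun j => if j is j'.+1 then w j' else 4 * w 0%N) (fun s => cint `[(-1 : R), s] f).
Proof.
move=> hf; have nf := W_nb hf; split; first exact: nb_cint.
by exists f; split; first exact: cprim_cint nf.1.
Qed.

Lemma bsmooth_down q N f : bsmooth q.+1 N f -> bsmooth q N f.
Proof.
elim: q f => [|q IH] f /= [mf [bf [f' [pf hf']]]]; split => //; split => //.
by exists f'; split => //; exact: IH.
Qed.

Lemma bsmoothD q M N f g : bsmooth q M f -> bsmooth q N g ->
  bsmooth q (2 * M + 2 * N) (fun x => f x + g x).
Proof.
have aux F G : cmeas F -> cmeas G -> (forall x, I x -> cabs2 (F x) <= M) ->
    (forall x, I x -> cabs2 (G x) <= N) -> cmeas (fun x => F x + G x) /\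
    forall x, I x -> cabs2 (F x + G x) <= 2 * M + 2 * N.
  move=> [F1 F2] [G1 G2] hF hG; split.
    split; [apply: (@eq_measurable_fun _ _ _ _ _ (fun x => ReF F x + ReF G x))|
            apply: (@eq_measurable_fun _ _ _ _ _ (fun x => ImF F x + ImF G x))].
    - by move=> x _; rewrite /ReF Re_add.
    - exact: measurable_funD.
    - by move=> x _; rewrite /ImF Im_add.
    - exact: measurable_funD.
  move=> x Ix; apply: le_trans (cabs2D _ _) _.
  by have := hF x Ix; have := hG x Ix; lra.
elim: q f g => [|q IH] f g /= [mf [bf hf]] [mg [bg hg]]; have [h1 h2] := aux _ _ mf mg bf bg.
  by split.
case: hf => f' [pf hf']; case: hg => g' [pg hg']; do 2 (split => //).
by exists (fun x => f' x + g' x); split; [exact: cprimD|exact: IH].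
Qed.

Lemma bsmooth_le q M N f : M <= N -> bsmooth q M f -> bsmooth q N f.
Proof.
move=> MN; elim: q f => [|q IH] f /= [mf [bf hf]].
  by split => //; split => // x Ix; apply: le_trans (bf x Ix) MN.
case: hf => f' [pf hf']; split => //; split; first by move=> x Ix; apply: le_trans (bf x Ix) MN.
by exists f'; split => //; exact: IH.
Qed.

(** Leibniz's rule by induction on both products g' f and g f'. The weights must increase because in
    g' f the undifferentiated f, of weight [w j], stands where [w j.+1] is due. *)
Lemma W_mul q : exists c : R, 0 <= c /\ forall N (w : nat -> R) f g, 0 <= N ->
  (forall j, w j <= w j.+1) -> bsmooth q N g -> W q w f ->
  W q (fun j => c * N * w j) (fun x => g x * f x).
Proof.
elim: q => [|q [c [c0 IH]]].
  exists 1; split => // N w f g N0 wm [mg [bg _]] [nf _]; split => //.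
  by rewrite mul1r; exact: nbM_bounded.
exists (1 + 4 * c); split; first by lra.
move=> N w f g N0 wm hg hf.
have hgq := bsmooth_down hg; have hfq := W_down (leqnSn q) hf.
have /= [mg [bg [g' [pg hg']]]] := hg; have /= [nf [f' [pf hf']]] := hf.
have w0 := nb_ge0 nf.
split.
  apply: nb_le (nbM_bounded N0 mg bg nf).
  by rewrite -mulrA mulrDl mul1r lerDl !mulr_ge0.
exists (fun x => g' x * f x + g x * f' x); split; first exact: cprimM.
have h1 := IH N w f g' N0 wm hg' hfq.
have h2 := IH N (fun j => w j.+1) f' g N0 (fun j => wm j.+1) hgq hf'.
apply: W_le (WD h1 h2) => j jq /=.
have wj0 := W_ge0 hf' jq; have wj := wm j; have cN : 0 <= c * N by rewrite mulr_ge0.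
have := ler_wpM2l cN wj; have := mulr_ge0 N0 wj0.
lra.
Qed.

(* Truncated subtraction makes the exponent [2 * max (0, j - r)]. *)
Definition om (k : R) (r : nat) (M : R) (j : nat) : R := M * k ^+ (2 * (j - r)).

Lemma om_ge0 (k : R) r (M : R) j : 1 <= k -> 0 <= M -> 0 <= om k r M j.
Proof. by move=> k1 M0; rewrite mulr_ge0// exprn_ge0//; lra. Qed.

Lemma om_le k r M N j : 1 <= k -> M <= N -> om k r M j <= om k r N j.
Proof. by move=> k1 MN; rewrite ler_wpM2r// exprn_ge0//; lra. Qed.

Lemma om_incr (k : R) r (M : R) j : 1 <= k -> 0 <= M -> om k r M j <= om k r M j.+1.
Proof. by move=> k1 M0; rewrite ler_wpM2l// ler_weXn2l// leq_mul2l/= leq_sub2r. Qed.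

Lemma om_shift (k : R) r (M : R) j : om k r.+1 M j.+1 = om k r M j.
Proof. by rewrite /om subSS. Qed.

Lemma om_rank k r r' M j : 1 <= k -> 0 <= M -> (r' <= r)%N -> om k r M j <= om k r' M j.
Proof. by move=> k1 M0 rr; rewrite ler_wpM2l// ler_weXn2l// leq_mul2l/= leq_sub2l. Qed.

Lemma om_step (k : R) r (M : R) j : 1 <= k -> 0 <= M -> om k r M j.+1 <= k ^+ 2 * om k r M j.
Proof.
move=> k1 M0; rewrite /om mulrCA ler_wpM2l// -exprD ler_weXn2l//.
by rewrite -mulnS leq_mul2l /=; lia.
Qed.

(** This provides the condition on the top weight in [smoothing]; for r <= q the exponent is not
    truncated from q to q + 1. *)
Lemma om_top k r M q : (r <= q)%N -> om k r M q.+1 = k ^+ 2 * om k r M q.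
Proof. by move=> rq; rewrite /om mulrCA -exprD subSn// mulnS. Qed.

Lemma om_zeroS k M j : om k 0 M j.+1 = om k 0 (k ^+ 2 * M) j.
Proof. by rewrite /om !subn0 mulnS exprD; ring. Qed.

Lemma omZ k r c M j : c * om k r M j = om k r (c * M) j.
Proof. by rewrite /om mulrA. Qed.

Lemma W_omD q k r M N f g : W q (om k r M) f -> W q (om k r N) g ->
  W q (om k r (2 * M + 2 * N)) (fun x => f x + g x).
Proof. by move=> hf hg; apply: W_le (WD hf hg) => j _; rewrite !omZ /om -mulrDl. Qed.

Lemma W_omZ q k r M c f : W q (om k r M) f -> W q (om k r (cabs2 c * M)) (fun x => c * f x).
Proof. by move=> hf; apply: W_le (WZ c hf) => j _; rewrite omZ. Qed.

Lemma W_om_le q k r r' M N f : 1 <= k -> 0 <= M -> M <= N -> (r' <= r)%N ->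
  W q (om k r M) f -> W q (om k r' N) f.
Proof.
move=> k1 M0 MN rr; apply: W_le => j _.
by apply: le_trans (om_rank _ k1 M0 rr) _; exact: om_le.
Qed.

(** For j <= q <= r both truncated differences are 0. Ranks above q are thereby reduced to rank
    q. *)
Lemma W_om_sat q k r M f : (q <= r)%N -> W q (om k r M) f <-> W q (om k q M) f.
Proof.
move=> qr; split; apply: W_le => j jq; rewrite /om.
  by rewrite (_ : (j - r = j - q)%N)//; lia.
by rewrite (_ : (j - q = j - r)%N)//; lia.
Qed.

End Weighted.

(** * Oscillatory primitives *)

Section Oscillatory.
Variable R : realType.
Local Notation C := R[i].
Local Notation I := (@Iset R).
Local Notation "k %:K" := (Complex k 0 : C) (at level 2, format "k %:K").
Hint Resolve measurable_IsetR Iset_m1 Iset_1 measurable_Iset : core.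

Lemma cabs2_real (k : R) : cabs2 k%:K = k ^+ 2.
Proof. by rewrite /cabs2 /= expr0n /= addr0. Qed.

Definition csmooth (k : R) (f : R -> C) (s : R) : C :=
  Complex (rsmooth k (ReF f) s) (rsmooth k (ImF f) s).

Lemma cprim_csmooth k f : L2I f -> cprim (csmooth k f) (fun s => k%:K * (f s + (-1) * csmooth k f s)).
Proof.
move=> /L2IP [h1 h2]; apply/cprimP; split.
- apply: eq_rprim (rprim_rsmooth k h1) => s _ //.
  by rewrite /ReF Re_mul Re_add Re_mul /=; ring.
- apply: eq_rprim (rprim_rsmooth k h2) => s _ //.
  by rewrite /ImF Im_mul Im_add Im_mul /=; ring.
Qed.

Lemma nb_csmooth (k : R) f B : 0 < k -> nb f B -> nb (csmooth k f) B.
Proof.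
move=> k0 [hf]; rewrite L2sqE => hB.
have hY := cprim_L2I (cprim_csmooth k hf).
have /L2IP [y1 y2] := hY; have /L2IP [f1 f2] := hf.
split => //; rewrite L2sqE; apply: le_trans hB.
have -> : rint (fun x => cabs2 (f x)) 1 = rint (fun x => ReF f x ^+ 2) 1 + rint (fun x => ImF f x ^+ 2) 1.
  by apply: rintD => //; [case: f1|case: f2].
have -> : rint (fun x => cabs2 (csmooth k f x)) 1 =
    rint (fun x => rsmooth k (ReF f) x ^+ 2) 1 + rint (fun x => rsmooth k (ImF f) x ^+ 2) 1.
  by apply: rintD => //; [case: y1|case: y2].
by apply: lerD; exact: rsmooth_L2_le.
Qed.

(* [y] is [f] smoothed at scale [1/k] by inverting [1 + D/k]; the free constant in [y] is
   fixed by smoothing the top derivative of [f] and integrating back through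
   [y = f - y'/k], which avoids a boundary layer at [-1]. *)
Lemma smoothing (q : nat) : exists c : R, 1 <= c /\ forall (k : R) (w : nat -> R) f, 1 <= k ->
  (forall j, w j.+1 <= k ^+ 2 * w j) -> k ^+ 2 * w q <= w q.+1 -> W q w f ->
  exists y, let y' := fun x => k%:K * (f x + (-1) * y x) in
    [/\ cprim y y', nb y (c * w 0%N) & W q (fun j => c * w j.+1) y'].
Proof.
have cm1 : cabs2 (-1 : C) = 1 by rewrite /cabs2 /=; ring.
elim: q => [|q [c [c0 IH]]].
  (* y' = k (f - y) has squared norm at most k^2 (2 + 2) w 0, and k^2 w 0 <= w 1. *)
  exists 4; split; first by lra.
  move=> k w f k1 _ wtop [hf _]; have w0 := nb_ge0 hf.
  have ny : nb (csmooth k f) (w 0%N) by apply: nb_csmooth => //; lra.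
  exists (csmooth k f); split; first exact: cprim_csmooth hf.1.
    by apply: nb_le ny; lra.
  split => //; have := nbZ (k%:K) (nbD hf (nbZ (-1) ny)).
  by apply: nb_le; rewrite cabs2_real cm1 mul1r; nra.
exists (2 + 2 * c); split; first by lra.
move=> k w f k1 wk wtop [hf [f' [pf hf']]]; have w0 := nb_ge0 hf.
have k0 : k != 0 by apply: lt0r_neq0; lra.
have kK : k%:K * (k^-1)%:K = 1 :> C.
  by apply: complex_ext; rewrite ?Re_mul ?Im_mul /=; field.
have [y1 [py1 ny1 hy1]] := IH k (fun j => w j.+1) f' k1 (fun j => wk j.+1) wtop hf'.
pose y x := f x + (- (k^-1)%:K) * y1 x.
have E x : k%:K * (f x + (-1) * y x) = y1 x.
  transitivity ((k%:K * (k^-1)%:K) * y1 x); first by rewrite /y; ring.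
  by rewrite kK mul1r.
have py : cprim y (fun x => k%:K * (f x + (-1) * y x)).
  apply: eq_cprim (cprimD pf (cprimZ (- (k^-1)%:K) py1)) => x _ //.
  rewrite E; transitivity (f' x - (k%:K * (k^-1)%:K) * (f' x + (-1) * y1 x)); first by ring.
  by rewrite kK; ring.
have w1 := nb_ge0 ny1.
have cw j : 0 <= w j -> c * w j <= (2 + 2 * c) * w j by move=> wj; apply: ler_wpM2r => //; lra.
have wpos j : (j <= q)%N -> 0 <= w j.+1 by move=> jq; apply: W_ge0 hf' jq.
have wpos' j : (j <= q)%N -> 0 <= w j.+2.
  move=> jq; have := W_ge0 hy1 jq; rewrite pmulr_rge0//; lra.
exists y; split => //.
  apply: nb_le (nbD hf (nbZ (- (k^-1)%:K) ny1)).
  have -> : cabs2 (- (k^-1)%:K : C) = k ^- 2.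
    by rewrite /cabs2 /= oppr0 expr0n /= addr0 sqrrN exprVn.
  have : k ^- 2 * (c * w 1%N) <= k ^- 2 * (c * (k ^+ 2 * w 0%N)).
    by rewrite ler_wpM2l ?invr_ge0 ?exprn_ge0//; [lra|rewrite ler_wpM2l//; lra].
  have -> : k ^- 2 * (c * (k ^+ 2 * w 0%N)) = c * w 0%N by field.
  lra.
apply: (@eq_W _ _ _ y1); first by move=> x _; rewrite E.
split; first by apply: nb_le ny1; apply: cw; exact: wpos.
exists (fun x => k%:K * (f' x + (-1) * y1 x)); split => //.
by apply: W_le hy1 => j jq; apply: cw; exact: wpos'.
Qed.

(* On the part of [f] oscillating away from frequency [tau k] the operator [D + i tau k] is
   inverted with a gain [1/k]; the remainder is small, in the sense that its [j]-th derivative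
   is [O(k ^ (j - r))] even for [j < r]. *)
Lemma oscillatory_split (q : nat) (tau : R) r : tau != 0 -> (r <= q)%N ->
  exists c : R, 0 <= c /\ forall (k M : R) f, 1 <= k -> 0 <= M -> W q (om k r M) f ->
  exists a a' g, [/\ cprim a a', nb a (c * M / k ^+ 2), W q (om k r (c * M / k ^+ 2) \o succn) a',
    (forall x, I x -> a' x + Complex 0 (tau * k) * a x = f x + g x) &
    W q (om k 0 (c * M / k ^+ (2 * r))) g].
Proof.
move=> tau0; elim: r => [|r IH] rq.
  (* At rank 0 nothing is integrated: a = 0 and the remainder is -f. *)
  exists 1; split => // k M f k1 M0 hf; exists (fun=> 0), (fun=> 0), (fun x => (-1) * f x).
  have k2 : 0 <= 1 * M / k ^+ 2 by rewrite mul1r divr_ge0// exprn_ge0//; lra.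
  split; first exact: cprim_cst.
  - by apply: nb_cst; rewrite /cabs2 /= expr0n /= addr0 mulr0.
  - by apply: W_zero => j; exact: om_ge0.
  - by move=> x _; ring.
  have := W_omZ (-1) hf; apply: W_le => j _; apply: om_le => //.
  have -> : cabs2 (-1 : C) = 1 by rewrite /cabs2 /=; ring.
  by rewrite muln0 expr0 divr1.
have [c1 [c10 {}IH]] := IH (ltnW rq).
have [cy [cy1 smooth]] := smoothing q.
(* The squared modulus of 1 + i/tau. *)
pose u := (1 + tau ^- 2).
have tau2 : 0 <= tau ^- 2 by rewrite invr_ge0 sqr_ge0.
have u0 : 0 <= u by rewrite /u; lra.
exists (2 * (c1 * u * cy) + 2 * (tau ^- 2 * cy)); split.
  by apply: addr_ge0; rewrite !mulr_ge0//; lra.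
move=> k M f k1 M0 hf.
have k0 : 0 < k by lra.
have kn0 : k != 0 by exact: lt0r_neq0.
have k2 : 0 <= k ^- 2 by rewrite invr_ge0 sqr_ge0.
have top : k ^+ 2 * om k r.+1 M q <= om k r.+1 M q.+1 by rewrite om_top.
have [y] := smooth k (om k r.+1 M) f k1 (fun j => om_step _ _ k1 M0) top hf.
set y' := fun x => _; case=> py ny hy'.
have hy'' : W q (om k r (cy * M)) y'.
  by apply: W_le hy' => j _; rewrite om_shift omZ.
(* These satisfy d2 (i tau k) = 1 and d1 + d2 = 1/k. As f = y + y'/k, adding d2 y to the amplitude
   accounts for y and leaves d1 y', of rank r, to the induction hypothesis. *)
pose d1 : C := Complex k^-1 (k^-1 / tau); pose d2 : C := Complex 0 (- (k^-1 / tau)).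
have d1E : cabs2 d1 = u * k ^- 2 by rewrite /cabs2 /d1 /= /u; field; rewrite ?tau0 ?kn0.
have d2E : cabs2 d2 = tau ^- 2 * k ^- 2 by rewrite /cabs2 /d2 /=; field; rewrite ?tau0 ?kn0.
have hf1 := W_omZ d1 hy''; rewrite d1E in hf1.
set M1 := _ * (cy * M) in hf1.
have M10 : 0 <= M1 by rewrite /M1 !mulr_ge0//; lra.
have [a1 [a1' [g [pa1 na1 ha1 eq1 hg]]]] := IH k M1 _ k1 M10 hf1.
exists (fun x => a1 x + d2 * y x), (fun x => a1' x + d2 * y' x), g; split.
- by apply: cprimD => //; exact: cprimZ.
- apply: nb_le (nbD na1 (nbZ d2 ny)); rewrite d2E /M1 /om sub0n muln0 expr0 mulr1.
  have h : k ^- 2 * (c1 * u * cy * M * k ^- 2) <= 1 * (c1 * u * cy * M * k ^- 2).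
    rewrite ler_wpM2r ?mulr_ge0//; try lra.
    by rewrite invf_le1 ?exprn_gt0// exprn_ege1.
  lra.
- apply: W_le (WD ha1 (WZ d2 hy'')) => j _ /=; rewrite d2E om_shift !omZ.
  have X0 : 0 <= 2 * (c1 * M1 / k ^+ 2) by rewrite !mulr_ge0//; lra.
  apply: le_trans (lerD (om_step r j k1 X0) (lexx _)) _.
  rewrite omZ /om -mulrDl ler_wpM2r//; first by rewrite exprn_ge0//; lra.
  by rewrite le_eqVlt; apply/orP; left; apply/eqP; rewrite /M1; field; rewrite ?tau0 ?kn0.
- move=> x Ix.
  have e := eq1 x Ix.
  have d2k : d2 * Complex 0 (tau * k) = 1.
    by apply: complex_ext; rewrite ?Re_mul ?Im_mul /=; field; rewrite ?tau0 ?kn0.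
  have d12 : (d1 + d2) * k%:K = 1.
    by apply: complex_ext; rewrite ?Re_mul ?Im_mul ?Re_add ?Im_add /=; field; rewrite ?tau0 ?kn0.
  transitivity ((a1' x + Complex 0 (tau * k) * a1 x) + d2 * y' x + (d2 * Complex 0 (tau * k)) * y x).
    by ring.
  rewrite e d2k mul1r.
  transitivity (((d1 + d2) * k%:K) * (f x + (-1) * y x) + g x + y x); first by rewrite /y'; ring.
  by rewrite d12; ring.
- apply: W_le hg => j _; apply: om_le => //; rewrite /M1 mulnS exprD.
  have kr : 0 <= (k ^+ (2 * r))^-1 by rewrite invr_ge0 exprn_ge0//; lra.
  rewrite [(k ^+ 2 * k ^+ (2 * r))^-1]invfM; set z := (k ^+ (2 * r))^-1 in kr *.
  have p1 : 0 <= (c1 * u * cy) * M * (k ^- 2 * z) by rewrite !mulr_ge0//; lra.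
  have p2 : 0 <= (tau ^- 2 * cy) * M * (k ^- 2 * z) by rewrite !mulr_ge0//; lra.
  lra.
Qed.

End Oscillatory.

(** * Integration of oscillating functions from -1 *)

Section VolterraStep.
Variable R : realType.
Local Notation C := R[i].
Local Notation I := (@Iset R).
Hint Resolve measurable_IsetR Iset_m1 Iset_1 measurable_Iset : core.

Lemma cmeas_expi (c : R) : cmeas (fun x : R => expi (c * x)).
Proof. exact: cprim_cmeas (cprim_expi c). Qed.

Lemma nb_expiM c f B : nb f B -> nb (fun x : R => expi (c * x) * f x) B.
Proof.
move=> hf; rewrite -[B]mul1r; apply: nbM_bounded => //; first exact: cmeas_expi.
by move=> x _; rewrite cabs2_expi.
Qed.

(** Each derivative falling on the phase costs a factor |tau| k, which the weights of rank 0 allow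
    at every order. This is why the remainder in [oscillatory_split] is measured at rank 0. *)
Lemma W_expiM q (tau : R) : exists c : R, 0 <= c /\ forall (k M : R) g, 1 <= k -> 0 <= M ->
  W q (om k 0 M) g -> W q (om k 0 (c * M)) (fun t => expi (tau * k * t) * g t).
Proof.
elim: q => [|q [c [c0 IH]]].
  exists 1; split => // k M g k1 M0 [hg _]; split => //.
  by rewrite mul1r; exact: nb_expiM.
have t0 : 0 <= tau ^+ 2 by exact: sqr_ge0.
exists (1 + c * (2 + 2 * tau ^+ 2)); split; first by rewrite addr_ge0// mulr_ge0//; lra.
move=> k M g k1 M0 hg; have /= [ng [g' [pg hg']]] := hg.
have k2 : 0 <= k ^+ 2 by exact: sqr_ge0.
split.
  apply: nb_le (nb_expiM (tau * k) ng); apply: om_le => //.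
  by have := mulr_ge0 (mulr_ge0 c0 M0) t0; have := mulr_ge0 c0 M0; lra.
exists (fun t => expi (tau * k * t) * (g' t + Complex 0 (tau * k) * g t)); split.
  by apply: eq_cprim (cprimM (cprim_expi (tau * k)) pg) => x _ //; ring.
have h1 : W q (om k 0 (k ^+ 2 * M)) g' by apply: W_le hg' => j _; rewrite om_zeroS.
have h2 := W_omZ (Complex 0 (tau * k)) (W_down (leqnSn q) hg).
have E : cabs2 (Complex 0 (tau * k) : C) = tau ^+ 2 * k ^+ 2 by rewrite /cabs2 /=; ring.
rewrite E in h2.
have p0 : 0 <= 2 * (k ^+ 2 * M) + 2 * (tau ^+ 2 * k ^+ 2 * M) by have := mulr_ge0 k2 M0; have := mulr_ge0 (mulr_ge0 t0 k2) M0; lra.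
apply: W_le (IH k _ _ k1 p0 (W_omD h1 h2)).
move=> j _; rewrite om_zeroS; apply: om_le => //.
by have := mulr_ge0 k2 M0; lra.
Qed.

Lemma cintD f g s : I s -> L2I f -> L2I g ->
  cint `[(-1 : R), s] (fun x => f x + g x) = cint `[(-1 : R), s] f + cint `[(-1 : R), s] g.
Proof.
move=> Is hf hg.
have [_ /(_ s Is)] := cprimD (cprim_cint hf) (cprim_cint hg).
by rewrite !cint_m1 !add0r => ->.
Qed.

Lemma cprim_cintE F f : cprim F f -> F (-1) = 0 -> forall s, I s -> F s = cint `[(-1 : R), s] f.
Proof. by move=> [_ h] F0 s Is; rewrite h// F0 add0r. Qed.

Lemma eq_cint f g s : I s -> (forall x, I x -> f x = g x) ->
  cint `[(-1 : R), s] f = cint `[(-1 : R), s] g.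
Proof.
move=> Is fg; apply: complex_ext; apply: eq_rint => // x Ix; by rewrite /ReF /ImF fg.
Qed.

(** Integration from -1 leaves a non-oscillating endpoint contribution, so only the phases tau k and
    0 together are stable under integration. *)
Definition osc (q r : nat) (tau k M : R) (b : R -> C) :=
  exists A B, [/\ W q (om k r M) A, W q (om k r M) B &
    forall s, I s -> b s = expi (tau * k * s) * A s + B s].

Lemma osc_le q r r' (tau k M N : R) b : 1 <= k -> 0 <= M -> M <= N -> (r' <= r)%N ->
  osc q r tau k M b -> osc q r' tau k N b.
Proof.
by move=> k1 M0 MN rr [A [B [hA hB E]]]; exists A, B; split => //;
  [exact: W_om_le hA|exact: W_om_le hB].
Qed.

Lemma W_om_cint q (k : R) r (M : R) f : 1 <= k -> 0 <= M -> W q (om k r M) f ->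
  W q.+1 (om k r.+1 (4 * M)) (fun s => cint `[(-1 : R), s] f).
Proof.
move=> k1 M0 hf; apply: W_le (W_cint hf) => -[_|j jq]; last first.
  by rewrite om_shift; apply: om_le => //; lra.
have := W_nb hf => /nb_ge0 => _.
by rewrite /om !sub0n muln0 expr0 !mulr1.
Qed.

(** Let e be the phase and a' + i tau k a = f + g. Then (e a)' = e (f + g), so the integral of e f
    is e(s) a(s), minus the endpoint value of e a, minus the integral of e g. *)
Lemma osc_cint_expiM q r (tau : R) : exists c : R, 1 <= c /\ forall (k M : R) f, 1 <= k -> 0 <= M ->
  W q (om k r M) f ->
  osc q.+1 r.+1 tau k (c * M) (fun s => cint `[(-1 : R), s] (fun t => expi (tau * k * t) * f t)).
Proof.
have [->|tau0] := eqVneq tau 0.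
  exists 4; split; first by lra.
  move=> k M f k1 M0 hf; exists (fun=> 0), (fun s => cint `[(-1 : R), s] f); split.
  - by apply: W_zero => j; apply: om_ge0 => //; lra.
  - exact: W_om_cint.
  - move=> s Is; rewrite mulr0 add0r; apply: eq_cint => // x _.
    by rewrite !mul0r expi0 mul1r.
(* For r > q the weights seen at ranks r and r + 1 are those of ranks q and q + 1. *)
wlog rq : r / (r <= q)%N.
  move=> h; have [rq|qr] := leqP r q; first exact: h.
  have [c [c1 hc]] := h q (leqnn q).
  exists c; split => // k M f k1 M0 /(W_om_sat _ _ _ (ltnW qr)) hf.
  have [A [B [hA hB E]]] := hc k M f k1 M0 hf.
  by exists A, B; split => //; apply/(@W_om_sat R q.+1 k r.+1) => //; rewrite ltnS ltnW.
have [c [c0 hc]] := oscillatory_split tau0 rq.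
have [c' [c'0 hc']] := W_expiM q tau.
(* 20 = 2 * 2 * 5: the trace bound of a(-1) gives 5, the norm of a constant 2, the sum 2. 8 = 2 * 4
   comes from the integral of e g. *)
exists (1 + (20 * c + 8 * c' * c)); split.
  by rewrite lerDl addr_ge0// !mulr_ge0.
move=> k M f k1 M0 hf.
have k0 : 0 < k by lra.
have [a [a' [g [pa na ha E hg]]]] := hc k M f k1 M0 hf.
have cM : 0 <= c * M by rewrite mulr_ge0.
have ccM : 0 <= c' * (c * M) by rewrite mulr_ge0.
have k2 : c * M / k ^+ 2 <= c * M.
  by rewrite ler_pdivrMr ?exprn_gt0// ler_peMr// exprn_ege1.
have k20 : 0 <= c * M / k ^+ 2 by rewrite divr_ge0// exprn_ge0//; lra.
have na' : nb a' (c * M).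
  apply: nb_le (W_nb ha); rewrite /=; apply: le_trans (om_step _ _ k1 k20) _.
  by rewrite /om sub0n muln0 expr0 mulr1 mulrCA divff ?mulr1// expf_neq0// lt0r_neq0.
have hM : 0 <= c * M / k ^+ (2 * r) by rewrite divr_ge0// exprn_ge0//; lra.
have heg := hc' k _ g k1 hM hg.
pose c0' := - (expi (tau * k * (-1)) * a (-1)).
have c0'n : cabs2 c0' <= 5 * (c * M).
  rewrite (_ : c0' = (-1) * (expi (tau * k * (-1)) * a (-1))); last by rewrite /c0'; ring.
  rewrite !cabs2M cabs2_expi mul1r (_ : cabs2 (-1) = 1); last by rewrite /cabs2 /=; ring.
  by rewrite mul1r; have := cprim_start pa na na'; lra.
exists a, (fun s => c0' + (-1) * cint `[(-1 : R), s] (fun t => expi (tau * k * t) * g t)); split.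
- split; first by apply: nb_le na; rewrite /om sub0n muln0 expr0 mulr1; lra.
  exists a'; split => //; apply: W_le ha => j _ /=; rewrite om_shift.
  apply: le_trans (om_step _ _ k1 k20) _; rewrite omZ; apply: om_le => //.
  by rewrite mulrCA divff ?mulr1 ?expf_neq0 ?lt0r_neq0//; lra.
- have h1 : W q.+1 (om k r.+1 (10 * (c * M))) (fun=> c0').
    apply: W_cst; first by rewrite /om sub0n muln0 expr0 mulr1; lra.
    by move=> j; apply: om_ge0 => //; lra.
  have h2 : W q.+1 (om k r.+1 (4 * (c' * (c * M))))
      (fun s => cint `[(-1 : R), s] (fun t => expi (tau * k * t) * g t)).
    apply: W_le (W_cint heg) => -[_|j _].
      rewrite /om sub0n muln0 expr0 !mulr1 ler_wpM2l// ler_wpM2l//.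
      by rewrite ler_pdivrMr ?exprn_gt0// ler_peMr// exprn_ege1.
    rewrite om_shift /om subn0 mulrA -[_ / _]mulrA -mulrA.
    (* Here the smallness k^{-2r} of the remainder turns weights of rank 0 into weights of rank r;
       for j < r the left side is at most 1 and the truncated exponent is 0. *)
    have : k ^- (2 * r) * k ^+ (2 * j) <= k ^+ (2 * (j - r)).
      rewrite mulrC ler_pdivrMr ?exprn_gt0// -exprD ler_weXn2l//.
      by rewrite -mulnDr leq_mul2l /= addnC -leq_subLR.
    move=> h; have := ler_wpM2l ccM h.
    have : 0 <= k ^+ (2 * (j - r)) by rewrite exprn_ge0//; lra.
    move=> h3; have := mulr_ge0 ccM h3.
    rewrite !mulrA; lra.
  have := W_omD h1 (W_omZ (-1) h2).
  rewrite (_ : cabs2 (-1) = 1); last by rewrite /cabs2 /=; ring.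
  by apply: W_om_le => //; lra.
move=> s Is.
have pe : cprim (fun s => expi (tau * k * s) * a s)
    (fun t => expi (tau * k * t) * f t + expi (tau * k * t) * g t).
  apply: eq_cprim (cprimM (cprim_expi (tau * k)) pa) => x Ix //.
  by rewrite -mulrDr -E//; ring.
have [_ /(_ s Is)] := pe; rewrite cintD//.
- move=> ->; rewrite /c0'; ring.
- exact: (nb_expiM _ (W_nb hf)).1.
- exact: (nb_expiM _ (W_nb hg)).1.
Qed.

Lemma osc_cint q r (tau : R) : exists c : R, 1 <= c /\ forall (k M : R) b, 1 <= k -> 0 <= M ->
  osc q r tau k M b -> osc q.+1 r.+1 tau k (c * M) (fun s => cint `[(-1 : R), s] b).
Proof.
have [c [c1 hc]] := osc_cint_expiM q r tau.
exists (2 * c + 8); split; first by lra.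
move=> k M b k1 M0 [A [B [hA hB E]]].
have [A1 [B1 [hA1 hB1 E1]]] := hc k M A k1 M0 hA.
have hB2 := W_om_cint k1 M0 hB.
have cM : 0 <= c * M by rewrite mulr_ge0//; lra.
exists A1, (fun s => B1 s + cint `[(-1 : R), s] B); split.
- by apply: W_om_le hA1 => //; lra.
- by apply: W_om_le (W_omD hB1 hB2) => //; lra.
move=> s Is; rewrite (eq_cint Is E) cintD//; last exact: (W_nb hB).1.
  by rewrite E1//; ring.
exact: (nb_expiM _ (W_nb hA)).1.
Qed.

End VolterraStep.

(** * Volterra operators *)

Section KernelFamily.
Variable R : realType.
Local Notation C := R[i].
Local Notation I := (@Iset R).
Hint Resolve measurable_IsetR Iset_m1 Iset_1 measurable_Iset : core.

(* [L j] plays the role of the [j]-th derivative in [s] of the kernel. *)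
Definition kfamily (m : nat) (L : nat -> R -> R -> C) :=
  [/\ forall j, (j < m)%N -> cprimkern (L j) (L j.+1),
      forall j, (j <= m)%N -> cckern (L j) &
      forall j, (j <= m)%N -> exists N, 0 <= N /\ bsmooth (m - j) N (fun s => L j s s)].

(** [i] counts derivatives: the integral with kernel [L (m - i)] is recovered from its derivative by
    [osc_cint]. The rank rises only once in all, because the diagonal term still has rank r and the
    other term is weakened to rank r before each integration. *)
Lemma osc_volterra m L (tau : R) r : kfamily m L -> forall i, (i <= m)%N ->
  exists c : R, 1 <= c /\ forall (k M : R) u, 1 <= k -> 0 <= M -> W m (om k r M) u ->
  osc i (if i is 0%N then r else r.+1) tau k (c * M)
    (fun s => cint `[(-1 : R), s] (fun t => L (m - i)%N s t * (expi (tau * k * t) * u t))).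
Proof.
move=> [kp kc kd]; elim=> [|i IH] im.
  rewrite subn0; have [N [N0 hN]] := cckern_bounded (kc m (leqnn m)).
  exists (1 + 4 * N); split; first by lra.
  move=> k M u k1 M0 hu; exists (fun=> 0), (fun s => cint `[(-1 : R), s] (fun t => L m s t * (expi (tau * k * t) * u t))).
  have NM := mulr_ge0 N0 M0.
  split.
  - by apply: W_zero => j; apply: om_ge0 => //; lra.
  - split => //; apply: nb_le (nb_volterra (kc m (leqnn m)) N0 hN (nb_expiM (tau * k) (W_nb hu))).
    by rewrite /om sub0n muln0 expr0 !mulr1; lra.
  - by move=> s _; rewrite mulr0 add0r.
have [c [c1 {}IH]] := IH (ltnW im).
set j := (m - i.+1)%N.
have jm : (j < m)%N by rewrite /j; lia.
have jS : (m - i)%N = j.+1 by rewrite /j; lia.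
have [N [N0 hN]] := kd j (ltnW jm).
have mji : (m - j = i.+1)%N by rewrite /j; lia.
rewrite mji in hN; have {}hN := bsmooth_down hN.
have [cm [cm0 hcm]] := W_mul R i.
have [c' [c'1 hc']] := osc_cint i r tau.
have cN := mulr_ge0 cm0 N0.
have h0 : 0 <= c' * (2 * (cm * N) + 2 * c) by rewrite mulr_ge0; lra.
exists (1 + c' * (2 * (cm * N) + 2 * c)); split; first by lra.
move=> k M u k1 M0 hu; have cM : 0 <= c * M by rewrite mulr_ge0//; lra.
have hi : osc i r tau k (c * M)
    (fun s => cint `[(-1 : R), s] (fun t => L j.+1 s t * (expi (tau * k * t) * u t))).
  have := IH k M u k1 M0 hu; rewrite jS; apply: osc_le => //.
  by case: (i) => // n; exact: leqnSn.
have [A [B [hA hB E]]] := hi.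
have hD := hcm N _ u _ N0 (fun j => om_incr r j k1 M0) hN (W_down (ltnW im) hu).
have hD' : W i (om k r (cm * N * M)) (fun x => L j x x * u x).
  by apply: W_le hD => l _; rewrite omZ.
have he : L2I (fun t => expi (tau * k * t) * u t) := (nb_expiM (tau * k) (W_nb hu)).1.
have cNM : 0 <= cm * N * M by rewrite mulr_ge0.
have ho : osc i r tau k (2 * (cm * N * M) + 2 * (c * M))
    (fun s => L j s s * (expi (tau * k * s) * u s) +
      cint `[(-1 : R), s] (fun t => L j.+1 s t * (expi (tau * k * t) * u t))).
  (* The diagonal term carries the phase tau k and joins the oscillating amplitude. *)
  exists (fun s => L j s s * u s + A s), B; split.
  - exact: W_omD.
  - by apply: W_om_le hB => //; lra.
  - by move=> s Is; rewrite E//; ring.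
have p0 : 0 <= 2 * (cm * N * M) + 2 * (c * M) by lra.
have [A1 [B1 [hA1 hB1 E1]]] := hc' k _ _ k1 p0 ho.
have pv := cprim_volterra (kp j jm) he.
have MM := mulr_ge0 h0 M0.
exists A1, B1; split.
- by apply: W_om_le hA1 => //; [rewrite mulr_ge0//; lra|lra].
- by apply: W_om_le hB1 => //; [rewrite mulr_ge0//; lra|lra].
move=> s Is; rewrite -E1//; exact: (cprim_cintE pv (cint_m1 _)).
Qed.

(** With limits independent of s, all derivatives fall on the kernel and cost no power of k. *)
Lemma W_fixed m L : kfamily m L -> forall i, (i <= m)%N ->
  exists c : R, 0 <= c /\ forall phi B, nb phi B ->
  W i (fun=> c * B) (fun s => cint I (fun t => L (m - i)%N s t * phi t)).
Proof.
move=> [kp kc _]; elim=> [|i IH] im.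
  rewrite subn0; have [N [N0 hN]] := cckern_bounded (kc m (leqnn m)).
  exists (4 * N); split; first by lra.
  move=> phi B hphi; split => //; rewrite -mulrA.
  exact: nb_fixed (kc m (leqnn m)) N0 hN hphi.
have [c [c0 {}IH]] := IH (ltnW im).
set j := (m - i.+1)%N.
have jm : (j < m)%N by rewrite /j; lia.
have jS : (m - i)%N = j.+1 by rewrite /j; lia.
have [N [N0 hN]] := cckern_bounded (kc j (ltnW jm)).
exists (c + 4 * N); split; first by lra.
move=> phi B hphi; have B0 := nb_ge0 hphi.
have cB := mulr_ge0 c0 B0; have NB := mulr_ge0 N0 B0.
split; first by apply: nb_le (nb_fixed (kc j (ltnW jm)) N0 hN hphi); lra.
exists (fun s => cint I (fun t => L j.+1 s t * phi t)); split.
  exact: cprim_fixed (kp j jm) hphi.1.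
by have := IH phi B hphi; rewrite jS; apply: W_le => l _; lra.
Qed.

(** The substance is the smoothness of the diagonal functions: each derivative along the diagonal
    spends one s- or one t-derivative of K, so starting from s-order j the total order stays at most
    m for m - j steps. *)
Lemma Cm2_kfamily m K : Cm2 m K -> exists L, kfamily m L /\
  forall s t, I s -> I t -> L 0%N s t = K s t.
Proof.
move=> [Kd [K0 [Kc [Kt Ks]]]].
pose L a b s t := Kd a b (clamp s) (clamp t).
have kc a b : (a <= m)%N -> (b <= m)%N -> cckern (L a b).
  move=> am bm; have [c1 c2] := Kc a b am bm; split.
  - exact: (@ckern_clamp _ (fun s t => complex.Re (Kd a b s t))).
  - exact: (@ckern_clamp _ (fun s t => complex.Im (Kd a b s t))).
have ks a b : (a < m)%N -> (b <= m)%N -> cprimkern (L a b) (L a.+1 b).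
  move=> am bm; have [c1 c2] := kc a b (ltnW am) bm; have [d1 d2] := kc a.+1 b am bm.
  split.
  - apply: (@primkern_derive _ (fun s t => complex.Re (Kd a b s t)) (fun s t => complex.Re (Kd a.+1 b s t))) => //.
    by move=> s t os ot; have [] := Ks a b am bm s t os ot.
  - apply: (@primkern_derive _ (fun s t => complex.Im (Kd a b s t)) (fun s t => complex.Im (Kd a.+1 b s t))) => //.
    by move=> s t os ot; have [] := Ks a b am bm s t os ot.
have kt a b : (a <= m)%N -> (b < m)%N -> cprimkern (fun s t => L a b t s) (fun s t => L a b.+1 t s).
  move=> + bm; elim: a => [|a IH] am.
    have [c1 c2] := kc 0%N b am (ltnW bm); have [d1 d2] := kc 0%N b.+1 am bm; split.
    - apply: (@primkern_derive _ (fun s t => complex.Re (Kd 0%N b t s)) (fun s t => complex.Re (Kd 0%N b.+1 t s))).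
      + exact: (ckern_swap c1).
      + exact: (ckern_swap d1).
      + by move=> s t os ot; have [] := Kt b bm t s ot os.
    - apply: (@primkern_derive _ (fun s t => complex.Im (Kd 0%N b t s)) (fun s t => complex.Im (Kd 0%N b.+1 t s))).
      + exact: (ckern_swap c2).
      + exact: (ckern_swap d2).
      + by move=> s t os ot; have [] := Kt b bm t s ot os.
  have [i1 i2] := IH (ltnW am); have [s1 s2] := ks a b am (ltnW bm).
  have [t1 t2] := ks a b.+1 am bm.
  by split; [exact: (primkern_swap s1 t1 i1)|exact: (primkern_swap s2 t2 i2)].
have kdiag a b : (a < m)%N -> (b < m)%N ->
    cprim (fun s => L a b s s) (fun s => L a.+1 b s s + L a b.+1 s s).
  move=> am bm; have [s1 s2] := ks a b am (ltnW bm).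
  have [t1 t2] := ks a b.+1 am bm; have [i1 i2] := kt a b (ltnW am) bm.
  apply/cprimP; split.
  - by apply: eq_rprim (primkern_diag s1 t1 i1) => x _ //; rewrite /ReF Re_add.
  - by apply: eq_rprim (primkern_diag s2 t2 i2) => x _ //; rewrite /ImF Im_add.
have kb q a b : (a + b + q <= m)%N -> exists N, 0 <= N /\ bsmooth q N (fun s => L a b s s).
  elim: q a b => [|q IH] a b abq.
    have kab : cckern (L a b) by apply: kc; lia.
    have [N [N0 hN]] := cckern_bounded kab; exists N; split => //; split => //.
    by split; [exact: (ckern_diag_meas kab.1)|exact: (ckern_diag_meas kab.2)].
  have kab : cckern (L a b) by apply: kc; lia.
  have [N [N0 hN]] := cckern_bounded kab.
  have [N1 [N10 h1]] : exists N, 0 <= N /\ bsmooth q N (fun s => L a.+1 b s s) by apply: IH; lia.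
  have [N2 [N20 h2]] : exists N, 0 <= N /\ bsmooth q N (fun s => L a b.+1 s s) by apply: IH; lia.
  exists (N + (2 * N1 + 2 * N2)); split; first by lra.
  split; first by split; [exact: (ckern_diag_meas kab.1)|exact: (ckern_diag_meas kab.2)].
  split; first by move=> x _; apply: le_trans (hN x x) _; lra.
  exists (fun s => L a.+1 b s s + L a b.+1 s s); split; first by apply: kdiag; lia.
  by apply: bsmooth_le (bsmoothD h1 h2); lra.
exists (fun j => L j 0%N); split.
  split => j jm; first exact: ks.
  - exact: kc.
  - by apply: kb; lia.
by move=> s t Is It; rewrite /L !clamp_id// K0.
Qed.

End KernelFamily.

(** * The oscillatory integral operator *)

(* A function with an [Hchain] need not be measurable itself, only almost everywhere equal to
   a measurable function, so [ae_eq_integral] does not apply to it. *)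
Section AeIntegral.
Local Open Scope ereal_scope.
Context d (T : measurableType d) (R : realType) (mu : {measure set T -> \bar R}).
Import HBNNSimple.

Lemma aeS (P Q : T -> Prop) : (forall x, P x -> Q x) ->
  {ae mu, forall x, P x} -> {ae mu, forall x, Q x}.
Proof. by move=> PQ; apply: filterS => x; exact: PQ. Qed.

(** The integral of a nonnegative function is the supremum over simple functions below it,
    measurable or not. Cutting such a simple function to 0 on a null set that contains the points
    where f and g differ puts it below g and keeps its integral. *)
Lemma ge0_ae_le_integral (f g : T -> \bar R) : (forall x, 0 <= f x) -> (forall x, 0 <= g x) ->
  {ae mu, forall x, f x = g x} -> \int[mu]_x f x <= \int[mu]_x g x.
Proof.
move=> f0 g0 [N [mN muN sub]].
rewrite !ge0_integralTE//; apply: ge_ereal_sup => /= _ [h hf <-].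
pose h' := proj_nnsfun h (measurableC mN).
suff -> : sintegral mu h = sintegral mu h'.
  apply: ereal_sup_ubound; exists h' => //= x; rewrite /h' /= mindicE.
  have [|xN] := boolP (x \in ~` N); last by rewrite mulr0; exact: g0.
  rewrite inE /= => xN; rewrite mulr1; apply: le_trans (hf x) _.
  suff -> : f x = g x by [].
  by apply: contrapT => fg; apply: xN; apply: sub.
have E (u : {nnsfun T >-> R}) : sintegral mu u = \int[mu]_x (u x)%:E.
  by rewrite integral_nnsfun// patch_setT.
rewrite !E; apply: ae_eq_integral => //.
- by apply/measurable_EFinP.
- by apply/measurable_EFinP.
exists N; split => // x /=; apply: contra_notP => xN _.
by rewrite /h' /= mindicE mem_set ?mulr1.
Qed.

Lemma ae_eq_integral_nonmeasurable (D : set T) (f g : T -> \bar R) :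
  {ae mu, forall x, D x -> f x = g x} -> \int[mu]_(x in D) f x = \int[mu]_(x in D) g x.
Proof.
move=> fg.
have fg' : {ae mu, forall x, (f \_ D) x = (g \_ D) x}.
  by apply: filterS fg => x h; rewrite !patchE; case: ifP => //; rewrite inE; exact: h.
rewrite integral_mkcond [RHS]integral_mkcond integralE [RHS]integralE.
have ge0_eq (u v : T -> \bar R) : (forall x, 0 <= u x) -> (forall x, 0 <= v x) ->
    {ae mu, forall x, u x = v x} -> \int[mu]_x u x = \int[mu]_x v x.
  move=> u0 v0 uv; apply/eqP; rewrite eq_le !ge0_ae_le_integral//.
  by apply: filterS uv => x.
congr (_ - _); apply: ge0_eq => //; apply: filterS fg' => x h.
- by rewrite !funeposE h.
- by rewrite !funenegE h.
Qed.

End AeIntegral.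

Section OscillatoryOperator.
Variable R : realType.
Local Notation C := R[i].
Local Notation mu := (@lebesgue_measure R).
Local Notation I := (@Iset R).
Hint Resolve measurable_IsetR Iset_m1 Iset_1 measurable_Iset : core.

Lemma ae_eq_cint (D : set R) (f g : R -> C) :
  {ae mu, forall x, D x -> f x = g x} -> cint D f = cint D g.
Proof.
move=> fg; apply: complex_ext; rewrite /cint /= /Rintegral; congr fine;
  apply: ae_eq_integral_nonmeasurable; apply: aeS fg => x h Dx; by rewrite /ReF /ImF h.
Qed.

Lemma rint_split (f f1 f2 : R -> R) s : I s -> rintegrable f -> rintegrable f2 ->
  (forall t, I t -> t <= s -> f t = f1 t) -> (forall t, I t -> s <= t -> f t = f2 t) ->
  rint f 1 = rint f1 s + (rint f2 1 - rint f2 s).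
Proof.
move=> Is hf hf2 h1 h2; have s1 : s <= 1 by move: Is => /Iset_itv/andP[].
have -> : rint f1 s = rint f s.
  apply: eq_Rintegral => t; rewrite inE /= => ht.
  rewrite h1//; first exact: subI ht.
  by move: ht; rewrite in_itv /= => /andP[].
have := rintB_itv Is (Iset_1 R) s1 hf; have := rintB_itv Is (Iset_1 R) s1 hf2.
have -> : \int[mu]_(x in `[s, 1]) f x = \int[mu]_(x in `[s, 1]) f2 x.
  apply: eq_Rintegral => t; rewrite inE /= => ht.
  rewrite h2//; first exact: (subI_itv Is (Iset_1 R)).
  by move: ht; rewrite in_itv /= => /andP[].
by move=> -> ->; rewrite addrC subrK.
Qed.

Lemma cintZ (c : C) f s : I s -> L2I f ->
  cint `[(-1 : R), s] (fun x => c * f x) = c * cint `[(-1 : R), s] f.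
Proof.
move=> Is hf; have [_ /(_ s Is)] := cprimZ c (cprim_cint hf).
by rewrite !cint_m1 mulr0 add0r => ->.
Qed.

Lemma cmeas_expi_norm (k s : R) : cmeas (fun t : R => expi (k * `|s - t|)).
Proof.
have c0 : continuous (fun t : R => k * `|s - t|).
  by move=> t; apply: cvgMr; apply: (cvg_norm (cvgB (cvg_cst s) cvg_id)).
split; apply: (@measurable_funS _ _ _ _ setT) => //; apply: continuous_measurable_fun => t.
- exact: (cvg_comp _ _ (c0 t) (@continuous_cos R _)).
- exact: (cvg_comp _ _ (c0 t) (@continuous_sin R _)).
Qed.

Lemma L2I_kernelM (L : R -> R -> C) (phi : R -> C) (s : R) : cckern L -> L2I phi -> L2I (fun t => L s t * phi t).
Proof.
move=> kL hphi; have [N [N0 hN]] := cckern_bounded kL.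
exact: (nb_kernelM s kL N0 hN (conj hphi (lexx _))).1.
Qed.

Lemma L2I_oscillatory (L : R -> R -> C) (phi : R -> C) (k s : R) : cckern L -> L2I phi ->
  L2I (fun t => L s t * expi (k * `|s - t|) * phi t).
Proof.
move=> kL hphi; apply: (@eq_L2I _ (fun t => L s t * (expi (k * `|s - t|) * phi t))).
  by move=> t _; rewrite mulrA.
apply: L2I_kernelM => //; apply: (L2IM_bounded (M := 1)) => //; first exact: cmeas_expi_norm.
by move=> x _; rewrite cabs2_expi.
Qed.

(** The part over [s, 1] is written as the integral over I minus that over [-1, s], so that every
    integral with a variable limit starts at -1, as in [osc_volterra]. *)
Lemma oscillatory_integral_split (L : R -> R -> C) (phi : R -> C) (k s : R) : cckern L -> L2I phi -> I s ->
  cint I (fun t => L s t * expi (k * `|s - t|) * phi t) =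
  expi (k * s) * cint `[(-1 : R), s] (fun t => L s t * (expi (- (k * t)) * phi t)) +
  expi (- (k * s)) * (cint I (fun t => L s t * (expi (k * t) * phi t)) -
                      cint `[(-1 : R), s] (fun t => L s t * (expi (k * t) * phi t))).
Proof.
move=> kL hphi Is.
have e1 : L2I (fun t => L s t * (expi (- (k * t)) * phi t)).
  apply: L2I_kernelM => //; apply: (@eq_L2I _ (fun t => expi (- k * t) * phi t)).
    by move=> t _; rewrite mulNr.
  exact: (nb_expiM (- k) (conj hphi (lexx _))).1.
have e2 : L2I (fun t => L s t * (expi (k * t) * phi t)).
  by apply: L2I_kernelM => //; exact: (nb_expiM k (conj hphi (lexx _))).1.
have e0 := L2I_oscillatory k s kL hphi.
pose F1 t := expi (k * s) * (L s t * (expi (- (k * t)) * phi t)).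
pose F2 t := expi (- (k * s)) * (L s t * (expi (k * t) * phi t)).
have F2i : L2I F2 by exact: (nbZ _ (conj e2 (lexx _))).1.
have h1 t : t <= s -> L s t * expi (k * `|s - t|) * phi t = F1 t.
  move=> ts; rewrite ger0_norm ?subr_ge0// mulrBr expiD /F1; ring.
have h2 t : s <= t -> L s t * expi (k * `|s - t|) * phi t = F2 t.
  move=> st; rewrite ler0_norm ?subr_le0// opprB mulrBr expiD /F2; ring.
rewrite mulrBr -cintZ// -[X in _ + (X - _)]cintZ// -cintZ// -/F1 -/F2.
have /L2IP [r0 i0] := e0; have /L2IP [r2 i2] := F2i.
have ReN (x : C) : complex.Re (- x) = - complex.Re x by case: x.
have ImN (x : C) : complex.Im (- x) = - complex.Im x by case: x.
apply: complex_ext; rewrite ?Re_add ?Im_add ?ReN ?ImN.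
- apply: rint_split => //; [exact: rL2_int|exact: rL2_int|..] => t _ ht; rewrite /ReF.
  - by rewrite (h1 t ht).
  - by rewrite (h2 t ht).
- apply: rint_split => //; [exact: rL2_int|exact: rL2_int|..] => t _ ht; rewrite /ImF.
  - by rewrite (h1 t ht).
  - by rewrite (h2 t ht).
Qed.

(** The inner integrals oscillate at sigma - 1 and sigma + 1. The outer factors e^{iks} and e^{-iks}
    bring their oscillating parts back to sigma k, and the non-oscillating parts acquire the phases
    k and -k. *)
Lemma oscillatory_term m L r (sigma : R) : (0 < m)%N -> kfamily m L ->
  exists c : R, 1 <= c /\ forall (k M : R) u, 1 <= k -> 0 <= M -> W m (om k r M) u ->
  exists A B D, [/\ W m (om k r.+1 (c * M)) A, W m (om k r.+1 (c * M)) B,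
    W m (om k r.+1 (c * M)) D & forall s, I s ->
    cint I (fun t => L 0%N s t * expi (k * `|s - t|) * (expi (sigma * k * t) * u t)) =
    expi (sigma * k * s) * A s + expi (k * s) * B s + expi (- (k * s)) * D s].
Proof.
move=> m0 fL; have [_ kc _] := fL.
have [c1 [c11 h1]] := osc_volterra (sigma - 1) r fL (leqnn m).
have [c2 [c21 h2]] := osc_volterra (sigma + 1) r fL (leqnn m).
have [c3 [c30 h3]] := W_fixed fL (leqnn m).
rewrite subnn in h1 h2 h3.
exists (2 * c1 + 2 * c2 + 2 * c3); split; first by lra.
move=> k M u k1 M0 hu; have nu := W_nb hu.
have {}h1 := h1 k M u k1 M0 hu; have {}h2 := h2 k M u k1 M0 hu.
have nu2 : nb (fun t => expi ((sigma + 1) * k * t) * u t) M.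
  by apply: nb_le (nb_expiM _ nu); rewrite /om sub0n muln0 expr0 mulr1.
have {}h3 := h3 _ _ nu2.
have em : (if m is 0%N then r else r.+1) = r.+1 by case: (m) m0.
rewrite em in h1 h2.
have [A1 [B1 [hA1 hB1 E1]]] := h1; have [A2 [B2 [hA2 hB2 E2]]] := h2.
have cm1 : cabs2 (-1 : C) = 1 by rewrite /cabs2 /=; ring.
have M1 : 0 <= c1 * M by rewrite mulr_ge0//; lra.
have M2 : 0 <= c2 * M by rewrite mulr_ge0//; lra.
have M3 : 0 <= c3 * M by rewrite mulr_ge0.
(* A constant weight lies below [om] of any rank, as k >= 1. *)
have h3' : W m (om k r.+1 (c3 * M)) (fun s => cint I (fun t => L 0%N s t * (expi ((sigma + 1) * k * t) * u t))).
  apply: W_le h3 => j _; rewrite /om ler_peMr// exprn_ege1//.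
exists (fun s => A1 s + (-1) * A2 s), B1,
  (fun s => cint I (fun t => L 0%N s t * (expi ((sigma + 1) * k * t) * u t)) + (-1) * B2 s); split.
- have := W_omD hA1 (W_omZ (-1) hA2); rewrite cm1 mul1r; apply: W_om_le => //; lra.
- by apply: W_om_le hB1 => //; lra.
- have := W_omD h3' (W_omZ (-1) hB2); rewrite cm1 mul1r; apply: W_om_le => //; lra.
move=> s Is.
have hphi : L2I (fun t => expi (sigma * k * t) * u t) := (nb_expiM (sigma * k) nu).1.
rewrite oscillatory_integral_split//; last exact: kc.
have -> : cint `[(-1 : R), s] (fun t => L 0%N s t * (expi (- (k * t)) * (expi (sigma * k * t) * u t))) =
    expi ((sigma - 1) * k * s) * A1 s + B1 s.
  rewrite -E1//; apply: eq_cint => // t _; congr (_ * _); rewrite mulrA -expiD.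
  by congr (expi _ * _); ring.
have E3 t : L 0%N s t * (expi (k * t) * (expi (sigma * k * t) * u t)) =
    L 0%N s t * (expi ((sigma + 1) * k * t) * u t).
  by congr (_ * _); rewrite mulrA -expiD; congr (expi _ * _); ring.
have -> : cint `[(-1 : R), s] (fun t => L 0%N s t * (expi (k * t) * (expi (sigma * k * t) * u t))) =
    expi ((sigma + 1) * k * s) * A2 s + B2 s.
  by rewrite -E2//; apply: eq_cint => // t _; exact: E3.
have -> : cint I (fun t => L 0%N s t * (expi (k * t) * (expi (sigma * k * t) * u t))) =
    cint I (fun t => L 0%N s t * (expi ((sigma + 1) * k * t) * u t)).
  by apply: (@eq_cint _ _ _ 1) => // t _; exact: E3.
have e1 : expi (sigma * k * s) = expi (k * s) * expi ((sigma - 1) * k * s) :> C.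
  by rewrite -expiD; congr expi; ring.
have e2 : expi (sigma * k * s) = expi (- (k * s)) * expi ((sigma + 1) * k * s) :> C.
  by rewrite -expiD; congr expi; ring.
transitivity ((expi (k * s) * expi ((sigma - 1) * k * s)) * A1 s + expi (k * s) * B1 s
  + expi (- (k * s)) * (cint I (fun t => L 0%N s t * (expi ((sigma + 1) * k * t) * u t)) - B2 s)
  - (expi (- (k * s)) * expi ((sigma + 1) * k * s)) * A2 s); first by ring.
by rewrite -e1 -e2; ring.
Qed.

Definition osc3 (m r : nat) (k M : R) (v : R -> C) :=
  exists v0 v1 v2, [/\ W m (om k r M) v0, W m (om k r M) v1, W m (om k r M) v2 &
    {ae mu, forall t, I t -> v t = v0 t + v1 t * expi (k * t) + v2 t * expi (- (k * t))}].

(** The phases 0, k and -k reproduce themselves: sigma = 1 returns its own phase to the amplitude of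
    e^{iks}, and sigma = -1 to that of e^{-iks}. *)
Lemma osc3_Kop m K r : (0 < m)%N -> Cm2 m K ->
  exists c : R, 1 <= c /\ forall (k M : R) v, 1 <= k -> 0 <= M ->
  osc3 m r k M v -> osc3 m r.+1 k (c * M) (Kop K k v).
Proof.
move=> m0 /Cm2_kfamily [L [fL LK]]; have [_ kc _] := fL.
have [c0 [c01 h0]] := oscillatory_term r 0 m0 fL.
have [c1 [c11 h1]] := oscillatory_term r 1 m0 fL.
have [c2 [c21 h2]] := oscillatory_term r (-1) m0 fL.
pose c := c0 + c1 + c2.
(* 22 = 2 + 2 (2 + 2 (2 + 2)): the amplitudes of e^{iks} and e^{-iks} are nested sums of four terms,
   and each sum doubles both bounds. *)
exists (22 * c); split; first by rewrite /c; lra.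
move=> k M v k1 M0 [v0 [v1 [v2 [hv0 hv1 hv2 E]]]].
have [A0 [B0 [D0 [hA0 hB0 hD0 E0]]]] := h0 k M v0 k1 M0 hv0.
have [A1 [B1 [D1 [hA1 hB1 hD1 E1]]]] := h1 k M v1 k1 M0 hv1.
have [A2 [B2 [D2 [hA2 hB2 hD2 E2]]]] := h2 k M v2 k1 M0 hv2.
have cM0 : 0 <= c0 * M by rewrite mulr_ge0//; lra.
have cM1 : 0 <= c1 * M by rewrite mulr_ge0//; lra.
have cM2 : 0 <= c2 * M by rewrite mulr_ge0//; lra.
have up0 f : W m (om k r.+1 (c0 * M)) f -> W m (om k r.+1 (c * M)) f.
  by apply: W_om_le => //; rewrite /c; lra.
have up1 f : W m (om k r.+1 (c1 * M)) f -> W m (om k r.+1 (c * M)) f.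
  by apply: W_om_le => //; rewrite /c; lra.
have up2 f : W m (om k r.+1 (c2 * M)) f -> W m (om k r.+1 (c * M)) f.
  by apply: W_om_le => //; rewrite /c; lra.
have cM : 0 <= c * M by rewrite /c; lra.
exists A0, (fun s => B0 s + (B2 s + (A1 s + B1 s))), (fun s => D0 s + (D1 s + (A2 s + D2 s))).
split.
- by apply: W_om_le (up0 _ hA0) => //; lra.
- apply: W_om_le (W_omD (up0 _ hB0) (W_omD (up2 _ hB2) (W_omD (up1 _ hA1) (up1 _ hB1)))) => //; lra.
- apply: W_om_le (W_omD (up0 _ hD0) (W_omD (up1 _ hD1) (W_omD (up2 _ hA2) (up2 _ hD2)))) => //; lra.
apply: aeW => s Is.
have kc0 := kc 0%N (leq0n m).
pose G (tau : R) w t := L 0%N s t * expi (k * `|s - t|) * (expi (tau * k * t) * w t).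
have hG tau w M' : W m (om k r M') w -> L2I (G tau w).
  by move=> hw; apply: L2I_oscillatory => //; exact: (nb_expiM (tau * k) (W_nb hw)).1.
have -> : Kop K k v s = cint I (fun t => G 0 v0 t + (G 1 v1 t + G (-1) v2 t)).
  apply: ae_eq_cint; apply: aeS E => t h It; rewrite (h It) -LK// /G !mul0r expi0 !mul1r.
  by rewrite (_ : - 1 * k * t = - (k * t)); [ring|ring].
have h12 : L2I (fun t => G 1 v1 t + G (-1) v2 t) by apply: L2ID; [exact: hG hv1|exact: hG hv2].
rewrite (@cintD _ _ _ 1)//; last exact: hG hv0.
rewrite (@cintD _ _ _ 1)//; [|exact: hG hv1|exact: hG hv2].
rewrite [X in X + _]E0// [X in _ + (X + _)]E1// [X in _ + (_ + X)]E2//.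
by rewrite !mul0r expi0 !mul1r (_ : - 1 * k * s = - (k * s)); [ring|ring].
Qed.

(** * Passage between derivative chains and weighted amplitudes *)

Lemma Hchain_W q (g : nat -> R -> C) (w : nat -> R) :
  (forall j, (j <= q)%N -> L2I (g j) /\ L2sq (g j) <= w j) ->
  (forall j, (j < q)%N -> forall s, I s -> g j s = g j (-1) + cint `[(-1 : R), s] (g j.+1)) ->
  W q w (g 0%N).
Proof.
elim: q g w => [|q IH] g w h1 h2; first by split => //; exact: h1.
split; first exact: h1.
exists (g 1%N); split; first by split; [exact: (h1 1%N _).1|exact: h2].
by apply: (IH (fun j => g j.+1)) => j jq; [exact: h1|exact: h2].
Qed.

Lemma W_Hchain q (f : R -> C) (w : nat -> R) : W q w f -> exists g : nat -> R -> C,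
  [/\ g 0%N = f, forall j, (j <= q)%N -> L2I (g j) /\ L2sq (g j) <= w j &
  forall j, (j < q)%N -> forall s, I s -> g j s = g j (-1) + cint `[(-1 : R), s] (g j.+1)].
Proof.
elim: q f w => [|q IH] f w [nf hf].
  by exists (fun=> f); split => // -[|j].
case: hf => f' [pf hf']; have [g [g0 g1 g2]] := IH _ _ hf'.
exists (fun j => if j is j'.+1 then g j' else f); split => //.
- by move=> [|j] //; exact: g1.
- by move=> [|j] jq s Is; [rewrite g0; exact: pf.2|exact: g2].
Qed.

Lemma L2sq_ge0 (f : R -> C) : 0 <= L2sq f.
Proof. by rewrite L2sqE; apply: rint_ge0 => // x _; exact: cabs2_ge0. Qed.

Lemma L2sq_le_Hnorm (g : nat -> R -> C) p j B : (j <= p)%N -> Hnorm g p <= B -> L2sq (g j) <= B ^+ 2.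
Proof.
move=> jp hB.
have S0 : 0 <= \sum_(i < p.+1) L2sq (g i) by apply: sumr_ge0 => i _; exact: L2sq_ge0.
have h : L2sq (g j) <= \sum_(i < p.+1) L2sq (g i).
  have jp' : (j < p.+1)%N by [].
  rewrite (bigD1 (Ordinal jp'))//= lerDl.
  by apply: sumr_ge0 => i _; exact: L2sq_ge0.
have B0 : 0 <= B by apply: le_trans hB; exact: sqrtr_ge0.
by apply: le_trans h _; rewrite -(sqr_sqrtr S0) ler_sqr ?nnegrE ?sqrtr_ge0.
Qed.

Lemma Hkappa_W m u : Hkappa m u -> exists (M : R -> R) (v : R -> R -> C) (c k0 : R),
  [/\ 0 < k0, forall k, 1 < k -> 0 <= M k, forall k, 1 < k -> k0 <= k -> M k = c,
    forall k, 1 < k -> W m (om k 0 (M k)) (v k) &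
    forall k, 1 < k -> {ae mu, forall t, I t -> u k t = v k t}].
Proof.
move=> [g [hg [c [k0 [c0 [k00 hb]]]]]].
(* Membership in H^m is needed for every k > 1, a uniform bound only from [k0] on; below [k0] the
   function's own squared norm serves as the constant. *)
pose M k := if k0 <= k then c ^+ 2 else \sum_(i < m.+1) L2sq (g k i).
exists M, (fun k => g k 0%N), (c ^+ 2), k0; split => //.
- move=> k _; rewrite /M; case: ifP => _; first exact: sqr_ge0.
  by apply: sumr_ge0 => i _; exact: L2sq_ge0.
- by move=> k _ h; rewrite /M h.
- move=> k k1; have [_ [h1 h2]] := hg k k1.
  apply: Hchain_W => // j jm; split; first exact: h1.
  rewrite /om subn0 /M; case: ifPn => hk.
    apply: le_trans (L2sq_le_Hnorm (leqnn j) (hb k k1 hk j jm)) _.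
    by rewrite exprMn -exprM mulnC.
  have jm' : (j < m.+1)%N by [].
  have S0 : 0 <= \sum_(i < m.+1) L2sq (g k i) by apply: sumr_ge0 => i _; exact: L2sq_ge0.
  apply: le_trans (ler_peMr S0 (exprn_ege1 _ (ltW k1))).
  rewrite (bigD1 (Ordinal jm'))//= lerDl.
  by apply: sumr_ge0 => i _; exact: L2sq_ge0.
- move=> k k1; have [h _] := hg k k1.
  by apply: aeS h => t h It; rewrite h.
Qed.

Lemma W_Hkappak m n (M : R -> R) (v : R -> R -> C) (c k0 : R) : 0 < k0 ->
  (forall k, 1 < k -> k0 <= k -> M k = c) -> (forall k, 1 < k -> 0 <= M k) ->
  (forall k, 1 < k -> W m (om k n (M k)) (v k)) -> Hkappak m (m - n) v.
Proof.
move=> k00 hM M0 hW.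
have /choice [g hg] : forall k, exists g : nat -> R -> C, 1 < k ->
    [/\ g 0%N = v k, forall j, (j <= m)%N -> L2I (g j) /\ L2sq (g j) <= om k n (M k) j &
    forall j, (j < m)%N -> forall s, I s -> g j s = g j (-1) + cint `[(-1 : R), s] (g j.+1)].
  move=> k; have [k1|k1] := ltP 1 k; last by exists (fun _ _ => 0).
  by have [g hg] := W_Hchain (hW k k1); exists g.
exists g; split.
  move=> k k1; have [g0 g1 g2] := hg k k1; split; first by apply: aeW => x _; rewrite g0.
  by split => // j jm; have [] := g1 j jm.
(* Each of the m + 1 squared norms is at most c k^(2 (m - n)); the added 1 makes the constant
   positive. *)
exists (Num.sqrt (m.+1%:R * c) + 1), k0; split; first by rewrite ltr_pwDr// sqrtr_ge0.
split => // k k1 kk0; have [g0 g1 g2] := hg k k1.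
have c0 : 0 <= c by rewrite -(hM k k1 kk0); exact: M0.
have kp : 0 <= k ^+ (m - n) by rewrite exprn_ge0//; lra.
apply: (@le_trans _ _ (Num.sqrt (m.+1%:R * c) * k ^+ (m - n))); last first.
  by rewrite ler_wpM2r// lerDl.
rewrite -[X in _ * X](ger0_norm kp) -sqrtr_sqr -sqrtrM ?mulr_ge0// ler_wsqrtr//.
apply: (@le_trans _ _ (\sum_(j < m.+1) c * k ^+ (m - n) ^+ 2)).
  apply: ler_sum => j _; have jm : (j <= m)%N by rewrite -ltnS.
  have [_ h] := g1 j jm; apply: le_trans h _; rewrite /om (hM k k1 kk0) ler_wpM2l// -exprM.
  by rewrite ler_weXn2l; [by []|lra|rewrite mulnC leq_mul2r leq_sub2r].
by rewrite sumr_const card_ord -(mulr_natl (c * _)) mulrA lexx.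
Qed.

End OscillatoryOperator.

Theorem theorem5p7 (R : realType) (m : nat) (K : R -> R -> R[i]) :
  (0 < m)%N -> Cm2 m K ->
  forall n : nat, (1 <= n <= m)%N ->
  forall u : R -> R -> R[i], Hkappa m u -> Htilde m (m - n) (Kpow K n u).
Proof.
move=> m0 hK n _ u /Hkappa_W [M [v [c [k0 [k00 M0 Mc hv uv]]]]].
(* The induction starts from zero applications, with rank 0 and all of u in phase 0. The factor [b]
   is uniform in k; all dependence on k below [k0] stays in [M k]. *)
have [b [b1 hb]] : exists b : R, 1 <= b /\ forall k, 1 < k ->
    osc3 m n k (b * M k) (Kpow K n u k).
  elim: n => [|n [b [b1 IH]]].
    exists 1; split => // k k1; rewrite mul1r.
    exists (v k), (fun=> 0), (fun=> 0); split; first exact: hv.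
    - by apply: W_zero => j; apply: om_ge0; [exact: ltW|exact: M0].
    - by apply: W_zero => j; apply: om_ge0; [exact: ltW|exact: M0].
    - by apply: aeS (uv k k1) => t h It; rewrite /Kpow /= h// !mul0r !addr0.
  have [b' [b'1 hb']] := osc3_Kop n m0 hK.
  exists (b' * b); split; first by rewrite mulr_ege1.
  move=> k k1; rewrite -mulrA; apply: hb'; [exact: ltW| |exact: IH].
  by rewrite mulr_ge0 ?M0//; lra.
have /choice [w hw] : forall k, exists w : (R -> R[i]) * (R -> R[i]) * (R -> R[i]), 1 < k ->
    [/\ W m (om k n (b * M k)) w.1.1, W m (om k n (b * M k)) w.1.2, W m (om k n (b * M k)) w.2 &
    {ae lebesgue_measure, forall t, Iset t -> Kpow K n u k t =
      w.1.1 t + w.1.2 t * expi (k * t) + w.2 t * expi (- (k * t))}].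
  move=> k; have [k1|k1] := ltP 1 k; last first.
    by exists (fun=> 0, fun=> 0, fun=> 0).
  by have [v0 [v1 [v2 h]]] := hb k k1; exists (v0, v1, v2).
have bM k : 1 < k -> k0 <= k -> b * M k = b * c by move=> k1 kk; rewrite Mc.
have bM0 k : 1 < k -> 0 <= b * M k by move=> k1; rewrite mulr_ge0 ?M0//; lra.
exists (fun k => (w k).1.1), (fun k => (w k).1.2), (fun k => (w k).2).
split; first by apply: (W_Hkappak k00 bM bM0) => k /hw [].
split; first by apply: (W_Hkappak k00 bM bM0) => k /hw [].
split; first by apply: (W_Hkappak k00 bM bM0) => k /hw [].
by move=> k /hw [].
Qed.
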